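(* Let $A$ be a quasi-category. Every adjunction in the slice 2-category $\mathrm{qCat}_2/A$ lifts, along the canonical 2-functor $h_*(\mathrm{qCat}_\infty/A)\to\mathrm{qCat}_2/A$, to an adjunction fibred over $A$, i.e. to an adjunction in the 2-category $h_*(\mathrm{qCat}_\infty/A)$.
   Context: A quasi-category is a simplicial set with fillers for all inner horns; functors are simplicial maps between quasi-categories. $\mathrm{qCat}_2$ is the strict 2-category of quasi-categories with hom-categories $\hom'(A,B)=h(B^A)$, where $B^A$ is the internal hom and $h\colon\mathrm{sSet}\to\mathrm{Cat}$ is left adjoint to the nerve. An isofibration is a functor of quasi-categories with the right lifting property against all inner horn inclusions and against $\Delta^0\hookrightarrow\mathbb I$, where $\mathbb I$ is the nerve of the category with two objects and a unique isomorphism between them. Both slices have as objects the isofibrations $p\colon E\to A$ of quasi-categories with codomain $A$ and as 1-cells from $p\colon E\to A$ to $q\colon F\to A$ the functors $E\to F$ commuting with the maps to $A$. $\mathrm{qCat}_2/A$: the hom-category $\hom'_A(p,q)$ is the fibre of $\hom'(E,q)\colon\hom'(E,F)\to\hom'(E,A)$ over $p$; so its 2-cells are 2-cells of $\mathrm{qCat}_2$ whose whiskering with $q$ is the identity 2-cell on $p$. $\mathrm{qCat}_\infty/A$: the simplicially enriched category whose hom-space $\hom_A(p,q)$ is the fibre of the isofibration $q^E\colon F^E\to A^E$ over the vertex $p$; it is a quasi-category. $h_*(\mathrm{qCat}_\infty/A)$ is the 2-category with the same objects and hom-categories $h(\hom_A(p,q))$. The canonical 2-functor $h_*(\mathrm{qCat}_\infty/A)\to\mathrm{qCat}_2/A$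 is the identity on objects and 1-cells and acts on hom-categories by the functors $h(\hom_A(p,q))\to\hom'_A(p,q)$ induced by the universal property of the fibre. *)

(* Defs.v *)
From mathcomp Require Import all_boot.
From mathcomp Require Import boolp.

Set Implicit Arguments.
Unset Strict Implicit.
Unset Printing Implicit Defensive.

Lemma sval_eq (T : Type) (P : T -> Prop) (x y : {x : T | P x}) :
  sval x = sval y -> x = y.
Proof. by case: x y => [x px] [y py] /= ?; apply: eq_exist. Qed.

Record category := Category {
  Ob :> Type;
  Hom : Ob -> Ob -> Type;
  idc : forall x, Hom x x;
  cmp : forall x y z, Hom y z -> Hom x y -> Hom x z;
  cmpA : forall x y z t (h : Hom z t) (g : Hom y z) (f : Hom x y),
    cmp h (cmp g f) = cmp (cmp h g) f;
  cmp1f : forall x y (f : Hom x y), cmp (idc y) f = f;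
  cmpf1 : forall x y (f : Hom x y), cmp f (idc x) = f }.
Arguments Hom {c} x y.
Arguments idc {c} x.
Arguments cmp {c x y z} g f.

Notation "g \oc f" := (cmp g f) (at level 50, left associativity).

Record functor (C D : category) := Functor {
  fob :> C -> D;
  farr : forall x y, Hom x y -> Hom (fob x) (fob y);
  farr1 : forall x, farr (idc x) = idc (fob x);
  farrM : forall x y z (g : Hom y z) (f : Hom x y),
    farr (g \oc f) = farr g \oc farr f }.
Arguments farr {C D} _ {x y} _.

(** Equality of two arrows of [C] whose endpoints are provably equal, but not
    necessarily convertible. *)
Inductive hom_eq (C : category) (x y : C) (f : Hom x y) :
  forall x' y' : C, Hom x' y' -> Prop := hom_eq_refl : hom_eq f f.

Definition arr_cast (C : category) (x x' y y' : C) (ex : x = x') (ey : y = y')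
    (f : Hom x y) : Hom x' y' :=
  match ex in _ = a, ey in _ = b return Hom a b with
  | erefl, erefl => f
  end.

Definition eq_arr (C : category) (x y : C) (e : x = y) : Hom x y :=
  arr_cast erefl e (idc x).

Lemma hom_eq_cast (C : category) (x x' y y' : C) (ex : x = x') (ey : y = y')
  (f : Hom x y) : hom_eq (arr_cast ex ey f) f.
Proof. by case: x' / ex; case: y' / ey. Qed.

Lemma hom_eqP (C : category) (x x' y y' : C) (f : Hom x y) (f' : Hom x' y') :
  hom_eq f f' -> exists (ex : x = x') (ey : y = y'), f' = arr_cast ex ey f.
Proof. by case; exists erefl, erefl. Qed.

Lemma hom_eq_eq (C : category) (x y : C) (f f' : Hom x y) :
  hom_eq f f' -> f = f'.
Proof.
case/hom_eqP => ex [ey ->].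
by rewrite (Prop_irrelevance ex erefl) (Prop_irrelevance ey erefl).
Qed.

Lemma hom_eq_of_eq (C : category) (x y : C) (f f' : Hom x y) :
  f = f' -> hom_eq f f'.
Proof. by move->. Qed.

Lemma hom_eq_sym (C : category) (x x' y y' : C) (f : Hom x y) (f' : Hom x' y') :
  hom_eq f f' -> hom_eq f' f.
Proof. by case. Qed.

Lemma hom_eq_trans (C : category) (x x' x'' y y' y'' : C) (f : Hom x y)
  (f' : Hom x' y') (f'' : Hom x'' y'') :
  hom_eq f f' -> hom_eq f' f'' -> hom_eq f f''.
Proof. by move=> H H'; case: H'; case: H. Qed.

Lemma hom_eq_cmp (C : category) (x x' y y' z z' : C)
  (g : Hom y z) (f : Hom x y) (g' : Hom y' z') (f' : Hom x' y') :
  hom_eq g g' -> hom_eq f f' -> hom_eq (g \oc f) (g' \oc f').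
Proof.
move=> /hom_eqP[ey [ez ->]] /hom_eqP[ex [ey' ->]].
case: z' / ez g' => _; case: x' / ex f' => _.
rewrite (Prop_irrelevance ey' ey) => {ey'}.
by case: y' / ey.
Qed.

Lemma hom_eq_idc (C : category) (x y : C) : x = y -> hom_eq (idc x) (idc y).
Proof. by move->. Qed.

Lemma hom_eq_farr (C D : category) (F : functor C D) (x x' y y' : C)
  (f : Hom x y) (f' : Hom x' y') : hom_eq f f' -> hom_eq (farr F f) (farr F f').
Proof. by case. Qed.

Lemma functor_eq (C D : category) (F G : functor C D) :
  (forall x, F x = G x) ->
  (forall x y (f : Hom x y), hom_eq (farr F f) (farr G f)) -> F = G.
Proof.
case: F G => [F0 F1 F2 F3] [G0 G1 G2 G3] /= /funext e.
case: G0 / e G1 G2 G3 => G1 G2 G3 e.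
have e1 : F1 = G1.
  apply: functional_extensionality_dep => x.
  apply: functional_extensionality_dep => y.
  apply: functional_extensionality_dep => f.
  exact: hom_eq_eq.
case: G1 / e1 G2 G3 e => G2 G3 _.
by rewrite (Prop_irrelevance F2 G2) (Prop_irrelevance F3 G3).
Qed.

Definition functor_comp (C D E : category) (G : functor D E) (F : functor C D) :
  functor C E.
Proof.
refine (@Functor C E (fun x => G (F x)) (fun x y f => farr G (farr F f)) _ _).
- by move=> x /=; rewrite !farr1.
- by move=> x y z g f /=; rewrite !farrM.
Defined.

Definition prod_cat (C D : category) : category.
Proof.
refine (@Category (C * D)%type
  (fun x y => (Hom x.1 y.1 * Hom x.2 y.2)%type)
  (fun x => (idc x.1, idc x.2))
  (fun x y z g f => (g.1 \oc f.1, g.2 \oc f.2)) _ _ _).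
- by move=> x y z t h g f; rewrite !cmpA.
- by move=> x y [f g]; rewrite !cmp1f.
- by move=> x y [f g]; rewrite !cmpf1.
Defined.

Lemma fibre_cat1 (C D : category) (G : functor C D) (d : D)
  (x : {x : C | G x = d}) : hom_eq (farr G (idc (sval x))) (idc d).
Proof. by rewrite farr1; apply: hom_eq_idc; exact: (svalP x). Qed.

Lemma fibre_catM (C D : category) (G : functor C D) (d : D) (x y z : C)
  (g : Hom y z) (f : Hom x y) :
  hom_eq (farr G g) (idc d) -> hom_eq (farr G f) (idc d) ->
  hom_eq (farr G (g \oc f)) (idc d).
Proof.
rewrite farrM -[in X in _ -> _ -> X](cmp1f (idc d)); exact: hom_eq_cmp.
Qed.

(** The subcategory of [C] of the objects sent to [d] and the arrows sent to
    the identity of [d]. *)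
Definition fibre_cat (C D : category) (G : functor C D) (d : D) : category.
Proof.
refine (@Category {x : C | G x = d}
  (fun x y => {f : Hom (sval x) (sval y) | hom_eq (farr G f) (idc d)})
  (fun x => exist _ (idc (sval x)) (fibre_cat1 x))
  (fun x y z g f =>
     exist _ (sval g \oc sval f) (fibre_catM (svalP g) (svalP f))) _ _ _).
- by move=> x y z t h g f; apply: sval_eq; rewrite /= cmpA.
- by move=> x y f; apply: sval_eq; rewrite /= cmp1f.
- by move=> x y f; apply: sval_eq; rewrite /= cmpf1.
Defined.

Lemma hom_eq_fibre (C D : category) (G : functor C D) (d : D)
  (x x' y y' : fibre_cat G d) (f : Hom x y) (f' : Hom x' y') :
  hom_eq (sval f) (sval f') -> hom_eq f f'.
Proof.
case: x y f => [x ex] [y ey] /= [f hf].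
case: x' y' f' => [x' ex'] [y' ey'] /= [f' hf'] /= e.
move: ex' ey' hf'; case: x' y' f' / e => ex' ey' hf'.
move: hf'; rewrite (Prop_irrelevance ex' ex) (Prop_irrelevance ey' ey) => hf'.
by rewrite (Prop_irrelevance hf' hf).
Qed.

(** The functor into the fibre induced by a functor into the total category
    whose composite with [G] is constant at [d]. *)
Definition fibre_lift (B C D : category) (G : functor C D) (d : D)
  (F : functor B C) (F0 : forall x, G (F x) = d)
  (F1 : forall x y (f : Hom x y), hom_eq (farr G (farr F f)) (idc d)) :
  functor B (fibre_cat G d).
Proof.
refine (@Functor B (fibre_cat G d) (fun x => exist _ (F x) (F0 x))
  (fun x y f => exist _ (farr F f) (F1 x y f)) _ _).
- by move=> x; apply: sval_eq; rewrite /= farr1.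
- by move=> x y z g f; apply: sval_eq; rewrite /= farrM.
Defined.

Definition app1 (C D E : category) (T : functor (prod_cat C D) E) (x : C) (y : D)
  : E := T (x, y).
Definition app2 (C D E : category) (T : functor (prod_cat C D) E)
    (x x' : C) (y y' : D) (f : Hom x x') (g : Hom y y') :
  Hom (app1 T x y) (app1 T x' y') := @farr _ _ T (x, y) (x', y') (f, g).

Lemma app2_id (C D E : category) (T : functor (prod_cat C D) E) (x : C) (y : D) :
  app2 T (idc x) (idc y) = idc (app1 T x y).
Proof. exact: (@farr1 _ _ T (x, y)). Qed.

Lemma app2M (C D E : category) (T : functor (prod_cat C D) E)
  (x x' x'' : C) (y y' y'' : D) (f' : Hom x' x'') (f : Hom x x')
  (g' : Hom y' y'') (g : Hom y y') :
  app2 T (f' \oc f) (g' \oc g) = app2 T f' g' \oc app2 T f g.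
Proof.
exact: (@farrM _ _ T (x, y) (x', y') (x'', y'') (f', g') (f, g)).
Qed.

Record two_cat := TwoCat {
  tob :> Type;
  thom : tob -> tob -> category;
  tid : forall a, thom a a;
  tcomp : forall a b c, functor (prod_cat (thom b c) (thom a b)) (thom a c);
  tcompA1 : forall a b c d (h : thom c d) (g : thom b c) (f : thom a b),
    app1 (tcomp a c d) h (app1 (tcomp a b c) g f) =
    app1 (tcomp a b d) (app1 (tcomp b c d) h g) f;
  tcompA2 : forall a b c d (h h' : thom c d) (g g' : thom b c)
      (f f' : thom a b) (w : Hom h h') (v : Hom g g') (u : Hom f f'),
    hom_eq (app2 (tcomp a c d) w (app2 (tcomp a b c) v u))
           (app2 (tcomp a b d) (app2 (tcomp b c d) w v) u);
  tcomp1f1 : forall a b (f : thom a b), app1 (tcomp a b b) (tid b) f = f;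
  tcomp1f2 : forall a b (f f' : thom a b) (u : Hom f f'),
    hom_eq (app2 (tcomp a b b) (idc (tid b)) u) u;
  tcompf11 : forall a b (f : thom a b), app1 (tcomp a a b) f (tid a) = f;
  tcompf12 : forall a b (f f' : thom a b) (u : Hom f f'),
    hom_eq (app2 (tcomp a a b) u (idc (tid a))) u }.
Arguments thom {t} a b.
Arguments tid {t} a.
Arguments tcomp {t} a b c.

Definition comp1 (K : two_cat) (a b c : K) (g : thom b c) (f : thom a b) :
  thom a c := app1 (tcomp a b c) g f.
Definition comp2 (K : two_cat) (a b c : K) (g g' : thom b c) (f f' : thom a b)
    (v : Hom g g') (u : Hom f f') : Hom (comp1 g f) (comp1 g' f') :=
  app2 (tcomp a b c) v u.

Notation "g \o1 f" := (comp1 g f) (at level 40, left associativity).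
Notation "v \o2 u" := (comp2 v u) (at level 40, left associativity).

Record two_functor (K L : two_cat) := TwoFunctor {
  tfob :> K -> L;
  tfhom : forall a b : K, functor (thom a b) (thom (tfob a) (tfob b));
  tf_id : forall a : K, tfhom a a (tid a) = tid (tfob a);
  tf_comp1 : forall (a b c : K) (g : thom b c) (f : thom a b),
    tfhom a c (g \o1 f) = tfhom b c g \o1 tfhom a b f;
  tf_comp2 : forall (a b c : K) (g g' : thom b c) (f f' : thom a b)
      (v : Hom g g') (u : Hom f f'),
    hom_eq (farr (tfhom a c) (v \o2 u))
           (farr (tfhom b c) v \o2 farr (tfhom a b) u) }.
Arguments tfhom {K L} t {a b}.

(** The triangle identities hold up to the strict associativity and unit laws
    for 1-cells, whence [eq_arr] and [hom_eq]. *)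
Record adjunction (K : two_cat) (a b : K) := Adjunction {
  ladj : thom a b;
  radj : thom b a;
  aunit : Hom (tid a) (radj \o1 ladj);
  acounit : Hom (ladj \o1 radj) (tid b);
  triangle_l :
    hom_eq ((acounit \o2 idc ladj) \oc eq_arr (tcompA1 ladj radj ladj)
              \oc (idc ladj \o2 aunit))
           (idc ladj);
  triangle_r :
    hom_eq ((idc radj \o2 acounit)
              \oc eq_arr (esym (tcompA1 radj ladj radj))
              \oc (aunit \o2 idc radj))
           (idc radj) }.

Record adjunction_over (K L : two_cat) (P : two_functor K L) (a b : K)
    (j : adjunction a b) (j' : adjunction (P a) (P b)) : Prop := AdjunctionOver {
  over_ladj : tfhom P (ladj j) = ladj j';
  over_radj : tfhom P (radj j) = radj j';
  over_unit : hom_eq (farr (tfhom P) (aunit j)) (aunit j');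
  over_counit : hom_eq (farr (tfhom P) (acounit j)) (acounit j') }.

(** [K(a, g) : K(a, b) -> K(a, c)] for [g : b -> c]. *)
Definition postcomp (K : two_cat) (a b c : K) (g : thom b c) :
  functor (thom a b) (thom a c).
Proof.
refine (@Functor _ _ (fun f => g \o1 f) (fun f f' u => idc g \o2 u) _ _).
- by move=> f; rewrite /comp2 app2_id.
- by move=> f f' f'' v u; rewrite /comp2 -app2M cmp1f.
Defined.

Arguments postcomp {K} a {b c} g.

Lemma hom_eq_comp2 (K : two_cat) (a b c : K)
  (g1 g1' g2 g2' : thom b c) (f1 f1' f2 f2' : thom a b)
  (v1 : Hom g1 g1') (v2 : Hom g2 g2') (u1 : Hom f1 f1') (u2 : Hom f2 f2') :
  hom_eq v1 v2 -> hom_eq u1 u2 -> hom_eq (v1 \o2 u1) (v2 \o2 u2).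
Proof. by case; case. Qed.

Section Slice.
Context (K : two_cat) (z : K) (I : Type) (dom : I -> K)
  (proj : forall i, thom (dom i) z).

Definition slice_hom (i j : I) : category :=
  fibre_cat (postcomp (dom i) (proj j)) (proj i).

Definition slice_id (i : I) : slice_hom i i :=
  exist _ (tid (dom i)) (tcompf11 (proj i)).

Lemma slice_compP1 (i j k : I) (g : slice_hom j k) (f : slice_hom i j) :
  proj k \o1 (sval g \o1 sval f) = proj i.
Proof.
apply: etrans (tcompA1 (proj k) (sval g) (sval f)) _.
apply: etrans (svalP f); congr (_ \o1 _); exact: (svalP g).
Qed.

Lemma slice_compP2 (i j k : I) (g g' : slice_hom j k) (f f' : slice_hom i j)
  (v : Hom g g') (u : Hom f f') :
  hom_eq (idc (proj k) \o2 (sval v \o2 sval u)) (idc (proj i)).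
Proof.
apply: hom_eq_trans (tcompA2 (idc (proj k)) (sval v) (sval u)) _.
apply: hom_eq_trans (svalP u).
by apply: hom_eq_comp2 => //; exact: (svalP v).
Qed.

Definition slice_comp (i j k : I) :
  functor (prod_cat (slice_hom j k) (slice_hom i j)) (slice_hom i k).
Proof.
refine (@Functor (prod_cat (slice_hom j k) (slice_hom i j)) (slice_hom i k)
  (fun gf => exist _ (sval gf.1 \o1 sval gf.2) (slice_compP1 gf.1 gf.2))
  (fun gf gf' vu => exist _ (sval vu.1 \o2 sval vu.2) (slice_compP2 vu.1 vu.2))
  _ _).
- by move=> [g f]; apply: sval_eq; exact: app2_id.
- by move=> x y t v u; apply: sval_eq; exact: app2M.
Defined.

(** The full sub-2-category of the strict slice of [K] over [z] on the objects
    [proj i : dom i -> z]: the hom-category from [proj i] to [proj j] is the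
    fibre of [K(dom i, proj j)] over [proj i]. *)
Definition slice_two_cat : two_cat.
Proof.
refine (@TwoCat I slice_hom slice_id slice_comp _ _ _ _ _ _).
- by move=> *; apply: sval_eq; exact: tcompA1.
- by move=> *; apply: hom_eq_fibre; exact: tcompA2.
- by move=> *; apply: sval_eq; exact: tcomp1f1.
- by move=> *; apply: hom_eq_fibre; exact: tcomp1f2.
- by move=> *; apply: sval_eq; exact: tcompf11.
- by move=> *; apply: hom_eq_fibre; exact: tcompf12.
Defined.
End Slice.

(** Monotone maps [[m] -> [n]], with [[n] = {0, ..., n} = 'I_n.+1]. *)
Definition Delta (m n : nat) :=
  {f : {ffun 'I_m.+1 -> 'I_n.+1} |
    [forall i : 'I_m.+1, forall j : 'I_m.+1, (i <= j) ==> (f i <= f j)]}.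

Definition dfun m n (a : Delta m n) : 'I_m.+1 -> 'I_n.+1 := val a.
Coercion dfun : Delta >-> Funclass.

Lemma dfun_mono m n (a : Delta m n) (i j : 'I_m.+1) : i <= j -> a i <= a j.
Proof. by move: (valP a) => /forallP/(_ i)/forallP/(_ j)/implyP; apply. Qed.

Lemma delta_eq m n (a b : Delta m n) : (forall i, a i = b i) -> a = b.
Proof. by move=> e; apply: val_inj; apply/ffunP. Qed.

Lemma mk_delta_subproof m n (f : 'I_m.+1 -> 'I_n.+1)
  (mono_f : forall i j : 'I_m.+1, i <= j -> f i <= f j) :
  [forall i : 'I_m.+1, forall j : 'I_m.+1, (i <= j) ==> (finfun f i <= finfun f j)].
Proof.
by apply/forallP => i; apply/forallP => j; apply/implyP; rewrite !ffunE => /mono_f.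
Qed.

Definition mk_delta m n (f : 'I_m.+1 -> 'I_n.+1)
    (mono_f : forall i j : 'I_m.+1, i <= j -> f i <= f j) : Delta m n :=
  exist _ (finfun f) (mk_delta_subproof mono_f).

Lemma mk_deltaE m n (f : 'I_m.+1 -> 'I_n.+1)
  (mono_f : forall i j : 'I_m.+1, i <= j -> f i <= f j) i :
  mk_delta mono_f i = f i.
Proof. by rewrite /mk_delta /dfun /= ffunE. Qed.

Definition did n : Delta n n := @mk_delta n n id (fun _ _ h => h).

Definition dcomp k m n (a : Delta m n) (b : Delta k m) : Delta k n :=
  @mk_delta k n (fun i => a (b i)) (fun _ _ h => dfun_mono a (dfun_mono b h)).

(** The unique map [[n] -> [0]], the vertex [i : [0] -> [n]] and the edge
    [i <= j : [1] -> [n]]. *)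
Definition dto0 n : Delta n 0 := @mk_delta n 0 (fun=> ord0) (fun _ _ _ => leqnn 0).

Definition dvtx n (i : 'I_n.+1) : Delta 0 n :=
  @mk_delta 0 n (fun=> i) (fun _ _ _ => leqnn i).

Lemma dedge_subproof n (i j : 'I_n.+1) (ij : i <= j) (k l : 'I_2) :
  k <= l -> (if k == ord0 then i else j) <= (if l == ord0 then i else j).
Proof.
case: (altP (l =P ord0)) => [-> | _]; last by case: eqP => // _.
by rewrite leqn0 => /eqP k0; have /eqP-> : k == ord0 by rewrite -val_eqE /= k0.
Qed.

Definition dedge n (i j : 'I_n.+1) (ij : i <= j) : Delta 1 n :=
  mk_delta (dedge_subproof ij).

Record sset := SSet {
  simplex :> nat -> Type;
  sact : forall m n, Delta m n -> simplex n -> simplex m;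
  sact1 : forall n (x : simplex n), sact (did n) x = x;
  sactM : forall k m n (a : Delta m n) (b : Delta k m) (x : simplex n),
    sact (dcomp a b) x = sact b (sact a x) }.
Arguments sact {s m n} a x.

Record smap (X Y : sset) := SMap {
  sfun :> forall n, X n -> Y n;
  snat : forall m n (a : Delta m n) (x : X n),
    sfun (sact a x) = sact a (sfun x) }.
Arguments sfun {X Y} _ n x.

Lemma smap_eq (X Y : sset) (f g : smap X Y) :
  (forall n x, f n x = g n x) -> f = g.
Proof.
case: f g => [f nf] [g ng] /= e.
have e' : f = g.
  by apply: functional_extensionality_dep => n; apply: funext => x.
by case: g / e' ng {e} => ng; rewrite (Prop_irrelevance nf ng).
Qed.

Definition smap_id (X : sset) : smap X X :=
  @SMap X X (fun _ x => x) (fun _ _ _ _ => erefl).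

Definition smap_comp (X Y Z : sset) (g : smap Y Z) (f : smap X Y) : smap X Z.
Proof.
refine (@SMap X Z (fun n x => g n (f n x)) _).
by move=> m n a x; rewrite !snat.
Defined.

Notation "g \os f" := (smap_comp g f) (at level 50, left associativity).

Definition sprod (X Y : sset) : sset.
Proof.
refine (@SSet (fun n => (X n * Y n)%type)
  (fun m n a x => (sact a x.1, sact a x.2)) _ _).
- by move=> n [x y]; rewrite !sact1.
- by move=> k m n a b [x y]; rewrite !sactM.
Defined.

Definition simplex_std (n : nat) : sset.
Proof.
refine (@SSet (fun m => Delta m n) (fun _ _ a b => dcomp b a) _ _).
- by move=> m a; apply: delta_eq => i; rewrite !mk_deltaE.
- by move=> k m l a b c; apply: delta_eq => i; rewrite !mk_deltaE.
Defined.

Definition subsset (X : sset) (P : forall n, X n -> Prop)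
    (actP : forall m n (a : Delta m n) x, P n x -> P m (sact a x)) : sset.
Proof.
refine (@SSet (fun n => {x : X n | P n x})
  (fun m n a x => exist _ (sact a (sval x)) (actP m n a (sval x) (svalP x))) _ _).
- by move=> n x; apply: sval_eq; rewrite /= sact1.
- by move=> k m n a b x; apply: sval_eq; rewrite /= sactM.
Defined.

Definition subsset_incl (X : sset) (P : forall n, X n -> Prop)
    (actP : forall m n (a : Delta m n) x, P n x -> P m (sact a x)) :
  smap (subsset actP) X :=
  @SMap (subsset actP) X (fun _ x => sval x) (fun _ _ _ _ => erefl).

(** The horn [Lambda^n_k]: the simplices of [Delta^n] missing some vertex other
    than [k]. *)
Definition horn_pred n (k : 'I_n.+1) m (a : simplex_std n m) : Prop :=
  exists2 i : 'I_n.+1, i != k & forall j, (a : Delta m n) j != i.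

Lemma horn_act n (k : 'I_n.+1) m l (a : Delta m l) (b : simplex_std n l) :
  horn_pred k b -> horn_pred k (sact a b).
Proof. by case=> i ik bi; exists i => // j; rewrite mk_deltaE. Qed.

Definition horn n (k : 'I_n.+1) : sset := subsset (@horn_act n k).
Definition horn_incl n (k : 'I_n.+1) : smap (horn k) (simplex_std n) :=
  subsset_incl (@horn_act n k).

Definition is_qcat (X : sset) : Prop :=
  forall n (k : 'I_n.+1), 0 < k < n -> forall u : smap (horn k) X,
    exists l : smap (simplex_std n) X, l \os horn_incl k = u.

Definition rlp (U V E B : sset) (i : smap U V) (p : smap E B) : Prop :=
  forall (u : smap U E) (v : smap V B), p \os u = v \os i ->
    exists l : smap V E, l \os i = u /\ p \os l = v.

Definition map_act (A B : sset) m n (a : Delta m n)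
  (f : smap (sprod A (simplex_std n)) B) : smap (sprod A (simplex_std m)) B.
Proof.
refine (@SMap (sprod A (simplex_std m)) B (fun k x => f k (x.1, dcomp a x.2)) _).
move=> k l b [x c] /=; rewrite -snat; congr (f _ (_, _)).
by apply: delta_eq => i; rewrite !mk_deltaE.
Defined.

Definition map_space (A B : sset) : sset.
Proof.
refine (@SSet (fun n => smap (sprod A (simplex_std n)) B) (@map_act A B) _ _).
- move=> n f; apply: smap_eq => k [x c]; congr (f _ (_, _)).
  by apply: delta_eq => i; rewrite !mk_deltaE.
- move=> k m n a b f; apply: smap_eq => l [x c]; congr (f _ (_, _)).
  by apply: delta_eq => i; rewrite !mk_deltaE.
Defined.

(** A vertex of [B^A] is a map [A x Delta^0 -> B]; maps [A -> B] are identified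
    with such vertices along [A x Delta^0 = A]. *)
Definition map_vertex (A B : sset) (f : smap A B) : map_space A B 0.
Proof.
refine (@SMap (sprod A (simplex_std 0)) B (fun n x => f n x.1) _).
by move=> m n a [x c]; rewrite snat.
Defined.

(** The [n]-simplex which is totally degenerate on a vertex; the case [n = 0] is
    singled out so that [cst 0 x] is [x] by computation. *)
Definition cst (X : sset) n (x : X 0) : X n :=
  match n return X n with
  | 0 => x
  | n'.+1 => sact (dto0 n'.+1) x
  end.

Lemma cstE (X : sset) n (x : X 0) : cst n x = sact (dto0 n) x.
Proof.
case: n => //=; rewrite -[LHS]sact1; congr sact; apply: delta_eq => i.
by rewrite !mk_deltaE [i]ord1.
Qed.

Lemma sact_cst (X : sset) m n (a : Delta m n) (x : X 0) :
  sact a (cst n x) = cst m x.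
Proof.
by rewrite !cstE -sactM; congr sact; apply: delta_eq => i; rewrite !mk_deltaE.
Qed.

Lemma smap_cst (X Y : sset) (f : smap X Y) n (x : X 0) :
  f n (cst n x) = cst n (f 0 x).
Proof. by rewrite !cstE snat. Qed.

Lemma fibre_act (X Y : sset) (f : smap X Y) (y : Y 0) m n (a : Delta m n) (x : X n) :
  f n x = cst n y -> f m (sact a x) = cst m y.
Proof. by move=> e; rewrite snat e sact_cst. Qed.

Definition sfibre (X Y : sset) (f : smap X Y) (y : Y 0) : sset :=
  subsset (@fibre_act X Y f y).
Definition sfibre_incl (X Y : sset) (f : smap X Y) (y : Y 0) :
  smap (sfibre f y) X := subsset_incl (@fibre_act X Y f y).

Definition ord_cat (n : nat) : category.
Proof.
refine (@Category 'I_n.+1 (fun i j => (i <= j : Prop)) (fun i => leqnn i)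
  (fun i j k jk ij => leq_trans ij jk) _ _ _);
  by move=> * /=; apply: Prop_irrelevance.
Defined.

Lemma ord_hom_eq n (i j : ord_cat n) (f g : Hom i j) : f = g.
Proof. exact: bool_irrelevance. Qed.

Definition ord_functor m n (a : Delta m n) : functor (ord_cat m) (ord_cat n).
Proof.
by refine (@Functor (ord_cat m) (ord_cat n) a (fun i j => @dfun_mono m n a i j) _ _);
  move=> * /=; apply: Prop_irrelevance.
Defined.

Definition nerve (C : category) : sset.
Proof.
refine (@SSet (fun n => functor (ord_cat n) C)
  (fun m n a F => functor_comp F (ord_functor a)) _ _).
- move=> n F; have e i : did n i = i by rewrite mk_deltaE.
  apply: functor_eq => [i|i j ij]; first by rewrite /= e.
  move: ij => /=; move: (dfun_mono _) => /= h ij; move: (h _ _ ij).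
  by rewrite !e => ij'; rewrite (Prop_irrelevance ij' ij).
- move=> k m n a b F; have e i : dcomp a b i = a (b i) by rewrite mk_deltaE.
  apply: functor_eq => [i|i j ij]; first by rewrite /= e.
  move=> /=; move: (dfun_mono (dcomp a b) _) (dfun_mono a _).
  by rewrite !e => h h'; rewrite (Prop_irrelevance h h').
Defined.

Definition nerve_map (C D : category) (F : functor C D) : smap (nerve C) (nerve D).
Proof.
refine (@SMap (nerve C) (nerve D) (fun n x => functor_comp F x) _).
by move=> m n a x; apply: functor_eq.
Defined.

Definition walking_iso : category.
Proof.
by refine (@Category bool (fun _ _ => unit) (fun=> tt) (fun _ _ _ _ _ => tt) _ _ _);
  move=> // x y [].
Defined.

Definition nerve_iso : sset := nerve walking_iso.

Definition iso_end : smap (simplex_std 0) nerve_iso.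
Proof.
refine (@SMap (simplex_std 0) nerve_iso (fun n _ =>
  @Functor (ord_cat n) walking_iso (fun=> false) (fun _ _ _ => tt)
    (fun=> erefl) (fun _ _ _ _ _ => erefl)) _).
by move=> *; apply: functor_eq.
Defined.

Definition is_isofib (E B : sset) (p : smap E B) : Prop :=
  (forall n (k : 'I_n.+1), 0 < k < n -> rlp (horn_incl k) p) /\ rlp iso_end p.

(** The type of classes of a relation, meant for equivalence relations. *)
Definition quot (T : Type) (R : T -> T -> Prop) :=
  {P : T -> Prop | exists x, P = R x}.
Definition cls (T : Type) (R : T -> T -> Prop) (x : T) : quot R :=
  exist _ (R x) (ex_intro _ x erefl).
Definition repr (T : Type) (R : T -> T -> Prop) (q : quot R) : T :=
  sval (cid (svalP q)).

Lemma reprK (T : Type) (R : T -> T -> Prop) (q : quot R) : cls R (repr q) = q.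
Proof. by apply: sval_eq; rewrite /repr /=; case: cid. Qed.

Definition vertex (X : sset) n (i : 'I_n.+1) (x : X n) : X 0 := sact (dvtx i) x.

Definition edge (X : sset) (x y : X 0) :=
  {e : X 1 | vertex ord0 e = x /\ vertex ord_max e = y}.

Inductive chain (X : sset) : X 0 -> X 0 -> Type :=
| cnil x : chain x x
| ccons x y z : edge x y -> chain y z -> chain x z.

Fixpoint capp (X : sset) (x y z : X 0) (p : chain x y) : chain y z -> chain x z :=
  match p in chain x y return chain y z -> chain x z with
  | cnil _ => fun q => q
  | ccons _ _ _ e p' => fun q => ccons e (capp p' q)
  end.

Definition cone (X : sset) (x y : X 0) (e : edge x y) : chain x y :=
  ccons e (cnil y).

Definition d01 : Delta 1 2 := @dedge 2 ord0 (@Ordinal 3 1 isT) isT.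
Definition d12 : Delta 1 2 := @dedge 2 (@Ordinal 3 1 isT) ord_max isT.
Definition d02 : Delta 1 2 := @dedge 2 ord0 ord_max isT.

(** The congruence on the free category on the edges of [X] generated by the
    degenerate edges and the 2-simplices. *)
Inductive ceqv (X : sset) : forall x y : X 0, chain x y -> chain x y -> Prop :=
| ceqv_refl x y (p : chain x y) : ceqv p p
| ceqv_sym x y (p q : chain x y) : ceqv p q -> ceqv q p
| ceqv_trans x y (p q r : chain x y) : ceqv p q -> ceqv q r -> ceqv p r
| ceqv_app x y z (p p' : chain x y) (q q' : chain y z) :
    ceqv p p' -> ceqv q q' -> ceqv (capp p q) (capp p' q')
| ceqv_deg x (e : edge x x) : sval e = cst 1 x -> ceqv (cone e) (cnil x)
| ceqv_tri x y z (f : edge x y) (g : edge y z) (h : edge x z) (t : X 2) :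
    sval f = sact d01 t -> sval g = sact d12 t -> sval h = sact d02 t ->
    ceqv (capp (cone f) (cone g)) (cone h).

Lemma cls_ceqv (X : sset) (x y : X 0) (p q : chain x y) :
  ceqv p q -> cls (@ceqv X x y) p = cls (@ceqv X x y) q.
Proof.
move=> pq; apply: sval_eq => /=; apply: funext => r; apply: propext; split.
  exact: ceqv_trans (ceqv_sym pq).
exact: ceqv_trans pq.
Qed.

Lemma repr_cls (X : sset) (x y : X 0) (p : chain x y) :
  ceqv (repr (cls (@ceqv X x y) p)) p.
Proof.
have /(congr1 sval)/= -> := reprK (cls (@ceqv X x y) p); exact: ceqv_refl.
Qed.

Lemma capp0 (X : sset) (x y : X 0) (p : chain x y) : capp p (cnil y) = p.
Proof. by elim: p => //= {}x {}y z e p ->. Qed.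

Lemma cappA (X : sset) (x y z t : X 0) (p : chain x y) (q : chain y z)
  (r : chain z t) : capp (capp p q) r = capp p (capp q r).
Proof. by elim: p q => //= {}x {}y w e p IH q; rewrite IH. Qed.

Definition hcomp (X : sset) (x y z : X 0) (b : quot (@ceqv X y z))
  (a : quot (@ceqv X x y)) : quot (@ceqv X x z) :=
  cls _ (capp (repr a) (repr b)).

Lemma hcomp_cls (X : sset) (x y z : X 0) (p : chain x y) (q : chain y z) :
  hcomp (cls (@ceqv X y z) q) (cls (@ceqv X x y) p) = cls _ (capp p q).
Proof. by apply/cls_ceqv/ceqv_app; exact: repr_cls. Qed.

Definition ho (X : sset) : category.
Proof.
refine (@Category (X 0) (fun x y => quot (@ceqv X x y))
  (fun x => cls _ (cnil x)) (@hcomp X) _ _ _).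
- move=> x y z t h g f; rewrite -(reprK h) -(reprK g) -(reprK f).
  by rewrite !hcomp_cls cappA.
- by move=> x y f; rewrite -(reprK f) hcomp_cls capp0.
- by move=> x y f; rewrite -(reprK f) hcomp_cls.
Defined.

Definition harr (X : sset) (x y : X 0) (e : edge x y) : @Hom (ho X) x y :=
  cls _ (cone e).

Lemma ho_ind (X : sset) (P : forall x y : ho X, Hom x y -> Prop) :
  (forall x, P x x (idc x)) ->
  (forall x y z (e : edge x y) (a : @Hom (ho X) y z),
     P y z a -> P x z (a \oc harr e)) ->
  forall x y (a : Hom x y), P x y a.
Proof.
move=> P1 PM x y a; rewrite -(reprK a).
move: (repr a) => {a} p; elim: p => [{}x|{}x {}y z e p IH]; first exact: P1.
by have := PM _ _ _ e _ IH; rewrite /= hcomp_cls.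
Qed.

Lemma hom_eq_harr (X : sset) (x x' y y' : X 0) (e : edge x y) (e' : edge x' y') :
  sval e = sval e' -> @hom_eq (ho X) _ _ (harr e) _ _ (harr e').
Proof.
case: e e' => [e [ex ey]] [e' [ex' ey']] /= ee'.
by case: x / ex; case: y / ey; case: x' / ex'; case: y' / ey'; case: e' / ee'.
Qed.

Lemma hom_eq_harr1 (X : sset) (x y z : X 0) (e : edge x y) :
  sval e = cst 1 z -> @hom_eq (ho X) _ _ (harr e) _ _ (@idc (ho X) z).
Proof.
move=> ez; have v i : vertex i (cst 1 z) = z.
  by rewrite /vertex sact_cst.
case: (svalP e); rewrite ez !v => ex ey.
case: x / ex e ez => e; case: y / ey e => e ez.
exact/hom_eq_of_eq/cls_ceqv/ceqv_deg.
Qed.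

Lemma harr_tri (X : sset) (x y z : X 0) (f : edge x y) (g : edge y z)
  (h : edge x z) (t : X 2) :
  sval f = sact d01 t -> sval g = sact d12 t -> sval h = sact d02 t ->
  (harr g : @Hom (ho X) y z) \oc harr f = harr h.
Proof.
by move=> ef eg eh; rewrite /= hcomp_cls; apply/cls_ceqv/(ceqv_tri ef eg eh).
Qed.

Lemma vertex_nat (X Y : sset) (f : smap X Y) n (i : 'I_n.+1) (x : X n) :
  vertex i (f n x) = f 0 (vertex i x).
Proof. by rewrite /vertex snat. Qed.

Lemma edge_map_subproof (X Y : sset) (f : smap X Y) (x y : X 0) (e : edge x y) :
  vertex ord0 (f 1 (sval e)) = f 0 x /\ vertex ord_max (f 1 (sval e)) = f 0 y.
Proof. by rewrite !vertex_nat; case: (svalP e) => -> ->. Qed.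

Definition edge_map (X Y : sset) (f : smap X Y) (x y : X 0) (e : edge x y) :
  edge (f 0 x) (f 0 y) := exist _ (f 1 (sval e)) (edge_map_subproof f e).

Fixpoint chain_map (X Y : sset) (f : smap X Y) (x y : X 0) (p : chain x y) :
  chain (f 0 x) (f 0 y) :=
  match p in chain x y return chain (f 0 x) (f 0 y) with
  | cnil x => cnil (f 0 x)
  | ccons _ _ _ e p' => ccons (edge_map f e) (chain_map f p')
  end.

Lemma chain_map_app (X Y : sset) (f : smap X Y) (x y z : X 0) (p : chain x y)
  (q : chain y z) : chain_map f (capp p q) = capp (chain_map f p) (chain_map f q).
Proof. by elim: p q => //= {}x {}y w e p IH q; rewrite IH. Qed.

Lemma chain_map_eqv (X Y : sset) (f : smap X Y) (x y : X 0) (p q : chain x y) :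
  ceqv p q -> ceqv (chain_map f p) (chain_map f q).
Proof.
elim=> {x y p q} /=.
- by move=> *; exact: ceqv_refl.
- by move=> *; exact: ceqv_sym.
- by move=> x y p q r _ pq _; exact: ceqv_trans.
- by move=> *; rewrite !chain_map_app; exact: ceqv_app.
- by move=> x e ee; apply: ceqv_deg; rewrite /= ee smap_cst.
- move=> x y z g h k t eg eh ek.
  by apply: (@ceqv_tri _ _ _ _ _ _ _ (f 2 t)) => /=;
    rewrite (eg, eh, ek) snat.
Qed.

Lemma ho_map_cls (X Y : sset) (f : smap X Y) (x y : X 0) (p : chain x y) :
  cls (@ceqv Y _ _) (chain_map f (repr (cls (@ceqv X x y) p)))
  = cls _ (chain_map f p).
Proof. exact/cls_ceqv/chain_map_eqv/repr_cls. Qed.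

Definition ho_map (X Y : sset) (f : smap X Y) : functor (ho X) (ho Y).
Proof.
refine (@Functor (ho X) (ho Y) (fun x => f 0 x)
  (fun x y a => cls _ (chain_map f (repr a))) _ _).
- by move=> x; rewrite ho_map_cls.
- move=> x y z b a; rewrite /= hcomp_cls -chain_map_app -(ho_map_cls f (capp _ _)).
  by rewrite -hcomp_cls !reprK.
Defined.

Lemma ho_map_harr (X Y : sset) (f : smap X Y) (x y : X 0) (e : edge x y) :
  farr (ho_map f) (harr e) = harr (edge_map f e).
Proof. exact: ho_map_cls. Qed.

Lemma ho_map_id (X : sset) (x y : ho X) (a : Hom x y) :
  farr (ho_map (smap_id X)) a = a.
Proof.
elim/ho_ind: a => {x y} [x|x y z e a IH]; first by rewrite farr1.
rewrite farrM IH ho_map_harr; congr (_ \oc _).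
exact/hom_eq_eq/hom_eq_harr.
Qed.

Lemma ho_map_comp (X Y Z : sset) (g : smap Y Z) (f : smap X Y) (x y : ho X)
  (a : Hom x y) : farr (ho_map (g \os f)) a = farr (ho_map g) (farr (ho_map f) a).
Proof.
elim/ho_ind: a => {x y} [x|x y z e a IH]; first by rewrite !farr1.
rewrite !farrM IH !ho_map_harr; congr (_ \oc _).
exact/hom_eq_eq/hom_eq_harr.
Qed.

Lemma hom_eq_ho_map (X Y : sset) (f g : smap X Y) (x y : ho X) (a : Hom x y) :
  (forall n t, f n t = g n t) -> hom_eq (farr (ho_map f) a) (farr (ho_map g) a).
Proof. by move=> /smap_eq ->. Qed.

Lemma hom_eq_ho_map2 (X Y Y' Z : sset) (f : smap X Y) (g : smap Y Z)
  (f' : smap X Y') (g' : smap Y' Z) (x y : ho X) (a : Hom x y) :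
  (forall n t, g n (f n t) = g' n (f' n t)) ->
  hom_eq (farr (ho_map g) (farr (ho_map f) a))
         (farr (ho_map g') (farr (ho_map f') a)).
Proof.
move=> e; have := @hom_eq_ho_map _ _ (g \os f) (g' \os f') x y a e.
by rewrite !ho_map_comp.
Qed.

(** [ho] is left adjoint to the nerve: [ho_unit] is natural in [X]
    ([ho_unit_nat]), and each [ho_unit X] is a universal arrow from [X] to
    [nerve] ([ho_universal]). *)
Lemma unit_edge_subproof (X : sset) n (i j : 'I_n.+1) (ij : i <= j) (x : X n) :
  vertex ord0 (sact (dedge ij) x) = vertex i x
  /\ vertex ord_max (sact (dedge ij) x) = vertex j x.
Proof.
by rewrite /vertex -!sactM; split; congr sact; apply: delta_eq => k;
  rewrite !mk_deltaE.
Qed.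

Definition unit_edge (X : sset) n (x : X n) (i j : 'I_n.+1) (ij : i <= j) :
  edge (vertex i x) (vertex j x) :=
  exist _ (sact (dedge ij) x) (unit_edge_subproof ij x).

Lemma dtri_subproof n (i j k : 'I_n.+1) (ij : i <= j) (jk : j <= k)
  (a b : 'I_3) : a <= b ->
  nth i [:: i; j; k] a <= nth i [:: i; j; k] b.
Proof.
have ik := leq_trans ij jk.
by case: a b => [[|[|[|n']]] ha] [[|[|[|n'']]] hb] //=.
Qed.

Definition dtri n (i j k : 'I_n.+1) (ij : i <= j) (jk : j <= k) : Delta 2 n :=
  mk_delta (dtri_subproof ij jk).

Definition unit_functor (X : sset) n (x : X n) : functor (ord_cat n) (ho X).
Proof.
refine (@Functor (ord_cat n) (ho X) (fun i => vertex i x)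
  (fun i j ij => harr (unit_edge x ij)) _ _).
- move=> i; apply/hom_eq_eq/hom_eq_harr1; rewrite cstE /= /vertex -sactM.
  by congr sact; apply: delta_eq => k; rewrite !mk_deltaE if_same.
- move=> i j k jk ij; apply/esym/(@harr_tri _ _ _ _ _ _ _ (sact (dtri ij jk) x));
    rewrite /= -sactM; congr sact; apply: delta_eq => l; rewrite !mk_deltaE;
    by case: (l == ord0).
Defined.

Definition ho_unit (X : sset) : smap X (nerve (ho X)).
Proof.
refine (@SMap X (nerve (ho X)) (@unit_functor X) _).
move=> m n a x; apply: functor_eq => [i|i j ij] /=.
  by rewrite /vertex -sactM; congr sact; apply: delta_eq => k; rewrite !mk_deltaE.
apply: hom_eq_harr; rewrite /= -sactM; congr sact; apply: delta_eq => k.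
by rewrite !mk_deltaE; case: (k == ord0).
Defined.

Lemma ho_unit_nat (X Y : sset) (f : smap X Y) :
  nerve_map (ho_map f) \os ho_unit X = ho_unit Y \os f.
Proof.
apply: smap_eq => n x; apply: functor_eq => [i|i j ij] /=.
  by rewrite vertex_nat.
by rewrite ho_map_cls; apply: hom_eq_harr; rewrite /= snat.
Qed.

Section HoUniversal.
Context (X : sset) (C : category) (g : smap X (nerve C)).

Let g0 (x : X 0) : C := (g 0 x : functor (ord_cat 0) C) ord0.
Let gn n (x : X n) : functor (ord_cat n) C := g n x.

Lemma ho_univ_vertex n (x : X n) (i : 'I_n.+1) : g0 (vertex i x) = gn x i.
Proof. by rewrite /g0 /vertex snat /= mk_deltaE. Qed.

Lemma ho_univ_act m n (a : Delta m n) (x : X n) (i j : 'I_m.+1) (ij : i <= j)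
  (k l : 'I_n.+1) (kl : k <= l) : a i = k -> a j = l ->
  hom_eq (farr (gn (sact a x)) (ij : @Hom (ord_cat m) i j))
         (farr (gn x) (kl : @Hom (ord_cat n) k l)).
Proof.
rewrite /gn snat /= => ei ej; move: (dfun_mono a ij).
rewrite ei ej => h; rewrite (Prop_irrelevance h kl); exact: hom_eq_refl.
Qed.

Lemma ho_univ_src (x y : X 0) (e : edge x y) : gn (sval e) ord0 = g0 x.
Proof. by rewrite -ho_univ_vertex; case: (svalP e) => -> _. Qed.

Lemma ho_univ_tgt (x y : X 0) (e : edge x y) : gn (sval e) ord_max = g0 y.
Proof. by rewrite -ho_univ_vertex; case: (svalP e) => _ ->. Qed.

Definition ho_univ_edge (x y : X 0) (e : edge x y) : Hom (g0 x) (g0 y) :=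
  arr_cast (ho_univ_src e) (ho_univ_tgt e)
    (farr (gn (sval e)) (isT : @Hom (ord_cat 1) ord0 ord_max)).

Fixpoint ho_univ_chain (x y : X 0) (p : chain x y) : Hom (g0 x) (g0 y) :=
  match p in chain x y return Hom (g0 x) (g0 y) with
  | cnil x => idc (g0 x)
  | ccons _ _ _ e p' => ho_univ_chain p' \oc ho_univ_edge e
  end.

Lemma ho_univ_app (x y z : X 0) (p : chain x y) (q : chain y z) :
  ho_univ_chain (capp p q) = ho_univ_chain q \oc ho_univ_chain p.
Proof.
by elim: p q => [{}x|{}x {}y w e p IH] q /=; rewrite ?cmpf1 // IH cmpA.
Qed.

Lemma ho_univ_edgeE (x y : X 0) (e : edge x y) n (t : X n) (i j : 'I_n.+1)
  (ij : i <= j) : sval e = sact (dedge ij) t ->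
  hom_eq (ho_univ_edge e) (farr (gn t) (ij : @Hom (ord_cat n) i j)).
Proof.
move=> ee; apply: hom_eq_trans (hom_eq_cast _ _ _) _; rewrite ee.
by apply: ho_univ_act; rewrite mk_deltaE.
Qed.

Lemma ho_univ_eqv (x y : X 0) (p q : chain x y) :
  ceqv p q -> ho_univ_chain p = ho_univ_chain q.
Proof.
elim=> {x y p q} //.
- by move=> x y p q r _ -> _ ->.
- by move=> *; rewrite !ho_univ_app; congr (_ \oc _).
- move=> x e ee; rewrite /= cmp1f; apply: hom_eq_eq.
  apply: hom_eq_trans (hom_eq_cast _ _ _) _; rewrite ee cstE.
  have h := leqnn (@ord0 0).
  apply: hom_eq_trans (ho_univ_act x _ h _ _) _; rewrite ?mk_deltaE //.
  by apply: hom_eq_of_eq; rewrite -[idc _]farr1; congr farr; exact: ord_hom_eq.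
- move=> x y z f k h t ef ek eh; rewrite /= !cmp1f; apply: hom_eq_eq.
  apply: hom_eq_trans (hom_eq_sym (ho_univ_edgeE eh)).
  apply: hom_eq_trans (hom_eq_cmp (ho_univ_edgeE ek) (ho_univ_edgeE ef)) _.
  apply: hom_eq_of_eq; rewrite -farrM; congr farr; exact: ord_hom_eq.
Qed.

Lemma ho_univ_cls (x y : X 0) (p : chain x y) :
  ho_univ_chain (repr (cls (@ceqv X x y) p)) = ho_univ_chain p.
Proof. exact/ho_univ_eqv/repr_cls. Qed.

Definition ho_univ : functor (ho X) C.
Proof.
refine (@Functor (ho X) C g0 (fun x y a => ho_univ_chain (repr a)) _ _).
- by move=> x; rewrite ho_univ_cls.
- by move=> x y z b a; rewrite ho_univ_cls ho_univ_app.
Defined.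

Theorem ho_universal :
  exists! F : functor (ho X) C, nerve_map F \os ho_unit X = g.
Proof.
exists ho_univ; split.
  apply: smap_eq => n x; apply: functor_eq => [i|i j ij] /=.
    exact: ho_univ_vertex.
  by rewrite ho_univ_cls /= cmp1f; apply: ho_univ_edgeE.
move=> F FE; have F0 x : g0 x = F x.
  by rewrite /g0 -FE /=; congr (F _); rewrite /vertex -[RHS]sact1; congr sact;
    apply: delta_eq => i; rewrite !mk_deltaE [i]ord1.
apply: functor_eq => // x y a; elim/ho_ind: a => {x y} [x|x y z e a IH].
  by rewrite !farr1; exact: hom_eq_idc.
rewrite !farrM; apply: hom_eq_cmp IH _; rewrite /= ho_univ_cls /= cmp1f.
apply: hom_eq_trans (hom_eq_cast _ _ _) _; rewrite /gn -FE /=.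
apply/hom_eq_farr/hom_eq_harr; rewrite /= -[RHS]sact1; congr sact.
apply: delta_eq => i; rewrite !mk_deltaE; case: eqP => [->//|].
by case: i => [[|[|i]] hi] ni //; apply: val_inj => //; case: ni; exact: val_inj.
Qed.
End HoUniversal.

Lemma smap_cst2 (X Y Z : sset) (m : smap (sprod X Y) Z) n (x : X 0) (y : Y 0) :
  m n (cst n x, cst n y) = cst n (m 0 (x, y)).
Proof. by rewrite -smap_cst; congr (m n _); case: n. Qed.

Definition sprod_l (X Y Z : sset) (m : smap (sprod X Y) Z) (y : Y 0) : smap X Z.
Proof.
refine (@SMap X Z (fun n x => m n (x, cst n y)) _).
by move=> k n a x; rewrite -(sact_cst a) -snat.
Defined.

Definition sprod_r (X Y Z : sset) (m : smap (sprod X Y) Z) (x : X 0) : smap Y Z.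
Proof.
refine (@SMap Y Z (fun n y => m n (cst n x, y)) _).
by move=> k n a y; rewrite -(sact_cst a) -snat.
Defined.

(** The two degeneracies [[2] -> [1]] sending [1] to [1], resp. to [0]. *)
Lemma dsup_subproof (i j : 'I_3) : i <= j ->
  (if i == ord0 then ord0 else ord_max : 'I_2)
   <= (if j == ord0 then ord0 else ord_max : 'I_2).
Proof. by case: i j => [[|i] ?] [[|j] ?]. Qed.

Lemma dinf_subproof (i j : 'I_3) : i <= j ->
  (if i == ord_max then ord_max else ord0 : 'I_2)
   <= (if j == ord_max then ord_max else ord0 : 'I_2).
Proof. by case: i j => [[|[|[|i]]] ?] [[|[|[|j]]] ?]. Qed.

Definition dsup : Delta 2 1 := mk_delta dsup_subproof.
Definition dinf : Delta 2 1 := mk_delta dinf_subproof.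

Lemma dsup_dinf (X : sset) (x y : X 0) (e : edge x y) :
  [/\ sact d01 (sact dsup (sval e)) = sval e,
      sact d12 (sact dsup (sval e)) = cst 1 y,
      sact d02 (sact dsup (sval e)) = sval e &
      [/\ sact d01 (sact dinf (sval e)) = cst 1 x,
          sact d12 (sact dinf (sval e)) = sval e &
          sact d02 (sact dinf (sval e)) = sval e]].
Proof.
case: e => e [ex ey] /=; rewrite -ex -ey /vertex -!sactM.
have tail (a b : Delta 1 1) : val (a ord0) = val (b ord0) ->
    val (a ord_max) = val (b ord_max) -> sact a e = sact b e.
  move=> ab0 ab1; congr sact; apply: delta_eq => -[[|[|//]] hi].
    by apply: val_inj; move: ab0; congr (val (a _) = val (b _)); exact: val_inj.
  by apply: val_inj; move: ab1; congr (val (a _) = val (b _)); exact: val_inj.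
have tail1 (a : Delta 1 1) : val (a ord0) = 0 -> val (a ord_max) = 1 ->
    sact a e = e.
  by move=> a0 a1; rewrite -[RHS]sact1; apply: tail; rewrite (a0, a1) mk_deltaE.
by split; last split; first [apply: tail1|apply: tail]; rewrite !mk_deltaE.
Qed.

Lemma ho_interchange (X Y Z : sset) (m : smap (sprod X Y) Z)
  (x x' : ho X) (a : Hom x x') (y y' : ho Y) (b : Hom y y') :
  (farr (ho_map (sprod_r m x')) b : @Hom (ho Z) (m 0 (x', y)) (m 0 (x', y')))
    \oc farr (ho_map (sprod_l m y)) a =
  (farr (ho_map (sprod_l m y')) a : @Hom (ho Z) (m 0 (x, y')) (m 0 (x', y')))
    \oc farr (ho_map (sprod_r m x)) b.
Proof.
elim/ho_ind: a => {x x'} [x|x x' x'' e a IH] in y y' b *.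
  by rewrite !farr1 cmp1f cmpf1.
rewrite !farrM cmpA IH -!cmpA; congr (_ \oc _) => {a IH x''}.
elim/ho_ind: b => {y y'} [y|y y' y'' f b IH].
  by rewrite !farr1 cmp1f cmpf1.
rewrite !farrM -cmpA [RHS]cmpA -IH -!cmpA; congr (_ \oc _) => {b IH y''}.
rewrite !ho_map_harr.
have [p1 p2 p3 [p4 p5 p6]] := dsup_dinf e.
have [q1 q2 q3 [q4 q5 q6]] := dsup_dinf f.
have hP : vertex ord0 (m 1 (sval e, sval f)) = m 0 (x, y) /\
          vertex ord_max (m 1 (sval e, sval f)) = m 0 (x', y').
  rewrite !vertex_nat; case: (svalP e) (svalP f) => [ex ex'] [fy fy'].
  by split; congr (m 0 (_, _)).
pose h : edge (m 0 (x, y)) (m 0 (x', y')) := exist _ _ hP.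
rewrite [LHS](@harr_tri _ _ _ _ _ _ h (m 2 (sact dsup (sval e), sact dinf (sval f)))).
- rewrite [RHS](@harr_tri _ _ _ _ _ _ h (m 2 (sact dinf (sval e), sact dsup (sval f)))) //.
  + by rewrite -snat /= p4 q1.
  + by rewrite -snat /= p5 q2.
  + by rewrite -snat /= p6 q3.
- by rewrite -snat /= p1 q4.
- by rewrite -snat /= p2 q5.
- by rewrite -snat /= p3 q6.
Qed.

(** Since [ho] preserves binary products, a map [X x Y -> Z] induces a functor
    [ho X x ho Y -> ho Z]; the image of [(a, b)] is the image of the composite
    of [(a, 1)] and [(1, b)]. *)
Definition ho2_arr (X Y Z : sset) (m : smap (sprod X Y) Z) (x x' : ho X)
    (a : Hom x x') (y y' : ho Y) (b : Hom y y') :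
    @Hom (ho Z) (m 0 (x, y)) (m 0 (x', y')) :=
  (farr (ho_map (sprod_r m x')) b : @Hom (ho Z) (m 0 (x', y)) (m 0 (x', y')))
    \oc farr (ho_map (sprod_l m y)) a.

Lemma ho2_arr_id (X Y Z : sset) (m : smap (sprod X Y) Z) (x : ho X) (y : ho Y) :
  ho2_arr m (idc x) (idc y) = idc (m 0 (x, y) : ho Z).
Proof. by rewrite /ho2_arr !farr1 cmp1f. Qed.

Lemma ho2_arrM (X Y Z : sset) (m : smap (sprod X Y) Z)
  (x x' x'' : ho X) (a' : Hom x' x'') (a : Hom x x')
  (y y' y'' : ho Y) (b' : Hom y' y'') (b : Hom y y') :
  ho2_arr m (a' \oc a) (b' \oc b) = ho2_arr m a' b' \oc ho2_arr m a b.
Proof.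
rewrite /ho2_arr !farrM -!cmpA; congr (_ \oc _).
by rewrite !cmpA ho_interchange.
Qed.

Definition ho2 (X Y Z : sset) (m : smap (sprod X Y) Z) :
  functor (prod_cat (ho X) (ho Y)) (ho Z) :=
  @Functor (prod_cat (ho X) (ho Y)) (ho Z) (fun x => m 0 (x.1, x.2))
    (fun x x' a => ho2_arr m a.1 a.2) (fun x => ho2_arr_id m x.1 x.2)
    (fun x x' x'' b a => ho2_arrM m b.1 a.1 b.2 a.2).

Lemma ho2_idl (X Y Z : sset) (m : smap (sprod X Y) Z) (x : ho X)
  (y y' : ho Y) (b : Hom y y') :
  ho2_arr m (idc x) b = farr (ho_map (sprod_r m x)) b.
Proof. by rewrite /ho2_arr (farr1 (ho_map (sprod_l m y))) cmpf1. Qed.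

Lemma ho2_idr (X Y Z : sset) (m : smap (sprod X Y) Z) (x x' : ho X)
  (a : Hom x x') (y : ho Y) :
  ho2_arr m a (idc y) = farr (ho_map (sprod_l m y)) a.
Proof. by rewrite /ho2_arr (farr1 (ho_map (sprod_r m x'))) cmp1f. Qed.

Lemma ho2_nat (X Y Z X' Y' Z' : sset) (m : smap (sprod X Y) Z)
  (m' : smap (sprod X' Y') Z') (f : smap X X') (g : smap Y Y') (k : smap Z Z')
  (x x' : ho X) (a : Hom x x') (y y' : ho Y) (b : Hom y y') :
  (forall n s t, k n (m n (s, t)) = m' n (f n s, g n t)) ->
  hom_eq (farr (ho_map k) (ho2_arr m a b))
         (ho2_arr m' (farr (ho_map f) a) (farr (ho_map g) b)).
Proof.
move=> e; rewrite /ho2_arr farrM.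
apply: hom_eq_cmp.
- apply: (@hom_eq_ho_map2 _ _ _ _ (sprod_r m x') k g
    (sprod_r m' (f 0 x')) _ _ b) => n t.
  by rewrite /= e smap_cst.
- apply: (@hom_eq_ho_map2 _ _ _ _ (sprod_l m y) k f
    (sprod_l m' (g 0 y)) _ _ a) => n t.
  by rewrite /= e smap_cst.
Qed.

Lemma ho2A (X Y Z U V W : sset) (m : smap (sprod X U) W) (m' : smap (sprod Y Z) U)
  (l : smap (sprod V Z) W) (l' : smap (sprod X Y) V)
  (x x' : ho X) (a : Hom x x') (y y' : ho Y) (b : Hom y y')
  (z z' : ho Z) (c : Hom z z') :
  (forall n r s t, m n (r, m' n (s, t)) = l n (l' n (r, s), t)) ->
  hom_eq (ho2_arr m a (ho2_arr m' b c)) (ho2_arr l (ho2_arr l' a b) c).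
Proof.
move=> e; rewrite /ho2_arr !farrM cmpA.
apply: hom_eq_cmp; first apply: hom_eq_cmp.
- have := @hom_eq_ho_map _ _ (sprod_r m x' \os sprod_r m' y')
    (sprod_r l (l' 0 (x', y'))) _ _ c.
  by rewrite ho_map_comp; apply => n t; rewrite /= e smap_cst2.
- apply: (@hom_eq_ho_map2 _ _ _ _ (sprod_l m' z) (sprod_r m x')
    (sprod_r l' x') (sprod_l l z) _ _ b) => n t.
  by rewrite /= e.
- have := @hom_eq_ho_map _ _ (sprod_l m (m' 0 (y, z)))
    (sprod_l l z \os sprod_l l' y) _ _ a.
  by rewrite ho_map_comp; apply => n t; rewrite /= -e smap_cst2.
Qed.

Record scat := SCat {
  sob :> Type;
  shom : sob -> sob -> sset;
  sid : forall a, shom a a 0;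
  scomp : forall a b c, smap (sprod (shom b c) (shom a b)) (shom a c);
  scompA : forall a b c d n (h : shom c d n) (g : shom b c n) (f : shom a b n),
    scomp a c d n (h, scomp a b c n (g, f))
      = scomp a b d n (scomp b c d n (h, g), f);
  scomp1f : forall a b n (f : shom a b n), scomp a b b n (cst n (sid b), f) = f;
  scompf1 : forall a b n (f : shom a b n), scomp a a b n (f, cst n (sid a)) = f }.
Arguments shom {s} a b.
Arguments sid {s} a.
Arguments scomp {s} a b c.

(** The 2-category [h_* S], with hom-categories [h (S(a, b))]. *)
Definition hstar (S : scat) : two_cat.
Proof.
refine (@TwoCat S (fun a b => ho (shom a b)) (fun a => sid a)
  (fun a b c => ho2 (scomp a b c)) _ _ _ _ _ _).
- by move=> a b c d h g f; exact: (@scompA S a b c d 0).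
- by move=> *; apply: ho2A => n r s t; exact: scompA.
- by move=> a b f; exact: (@scomp1f S a b 0).
- move=> a b f f' u; rewrite [app2 _ _ _]ho2_idl.
  have := @hom_eq_ho_map _ _ (sprod_r (scomp a b b) (sid b)) (smap_id _) _ _ u.
  by rewrite ho_map_id; apply => n t; exact: scomp1f.
- by move=> a b f; exact: (@scompf1 S a b 0).
- move=> a b f f' u; rewrite [app2 _ _ _]ho2_idr.
  have := @hom_eq_ho_map _ _ (sprod_l (scomp a a b) (sid a)) (smap_id _) _ _ u.
  by rewrite ho_map_id; apply => n t; exact: scompf1.
Defined.

(** [S(a, g) : S(a, b) -> S(a, c)] for a vertex [g] of [S(b, c)]. *)
Definition spostcomp (S : scat) (a b c : S) (g : shom b c 0) :
  smap (shom a b) (shom a c) := sprod_r (scomp a b c) g.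
Arguments spostcomp {S} a {b c} g.

Lemma postcomp_hstar (S : scat) (a b c : S) (g : shom b c 0)
  (f f' : ho (shom a b)) (u : Hom f f') :
  farr (postcomp (K := hstar S) a g) u = farr (ho_map (spostcomp a g)) u.
Proof. exact: ho2_idl. Qed.

Section SimplicialSlice.
Context (S : scat) (z : S) (I : Type) (dom : I -> S)
  (proj : forall i, shom (dom i) z 0).

Definition sslice_hom (i j : I) : sset :=
  sfibre (spostcomp (dom i) (proj j)) (proj i).

Lemma sslice_id_subproof (i : I) :
  spostcomp (dom i) (proj i) 0 (sid (dom i)) = cst 0 (proj i).
Proof. exact: (@scompf1 S _ _ 0). Qed.

Definition sslice_id (i : I) : sslice_hom i i 0 :=
  exist _ (sid (dom i)) (sslice_id_subproof i).

Lemma sslice_comp_subproof (i j k : I) n (g : sslice_hom j k n)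
  (f : sslice_hom i j n) :
  spostcomp (dom i) (proj k) n (scomp _ _ _ n (sval g, sval f)) = cst n (proj i).
Proof.
rewrite /= scompA; apply: etrans (svalP f).
by congr (scomp _ _ _ n (_, _)); exact: (svalP g).
Qed.

Definition sslice_comp (i j k : I) :
  smap (sprod (sslice_hom j k) (sslice_hom i j)) (sslice_hom i k).
Proof.
refine (@SMap (sprod (sslice_hom j k) (sslice_hom i j)) (sslice_hom i k)
  (fun n x => exist _ (scomp _ _ _ n (sval x.1, sval x.2))
                (sslice_comp_subproof x.1 x.2)) _).
by move=> m n a x; apply: sval_eq; rewrite /= -snat.
Defined.

Lemma sval_cst_fibre (X Y : sset) (f : smap X Y) (y : Y 0) n (x : sfibre f y 0) :
  sval (cst n x) = cst n (sval x).
Proof. by case: n. Qed.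

(** The simplicial slice of [S] over [z], on the objects [proj i : dom i -> z]:
    the hom-space from [proj i] to [proj j] is the fibre of [S(dom i, proj j)]
    over the vertex [proj i]. *)
Definition slice_scat : scat.
Proof.
refine (@SCat I sslice_hom sslice_id sslice_comp _ _ _).
- by move=> *; apply: sval_eq; exact: scompA.
- move=> i j n f; apply: sval_eq; rewrite -[RHS]scomp1f /=.
  by congr (scomp _ _ _ n (_, _)); exact: sval_cst_fibre.
- move=> i j n f; apply: sval_eq; rewrite -[RHS]scompf1 /=.
  by congr (scomp _ _ _ n (_, _)); exact: sval_cst_fibre.
Defined.

Lemma canonical_subproof (i j : I) (f f' : ho (sslice_hom i j)) (u : Hom f f') :
  hom_eq
    (farr (postcomp (K := hstar S) (dom i) (proj j))
       (farr (ho_map (sfibre_incl (spostcomp (dom i) (proj j)) (proj i))) u))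
    (@idc (thom (dom i : hstar S) z) (proj i)).
Proof.
set incl := sfibre_incl _ _.
suff H : hom_eq (farr (ho_map (spostcomp (dom i) (proj j) \os incl)) u)
                (@idc (ho (shom (dom i) z)) (proj i)).
  apply: hom_eq_trans H; rewrite ho_map_comp.
  exact/hom_eq_of_eq/postcomp_hstar.
elim/ho_ind: u => {f f'} [f|f f' f'' e u IH].
  by rewrite farr1; apply: hom_eq_idc; exact: (svalP f).
rewrite farrM -[X in hom_eq _ X]cmp1f; apply: hom_eq_cmp IH _.
by rewrite ho_map_harr; apply: hom_eq_harr1; exact: (svalP (sval e)).
Qed.

Definition canonical_hom (i j : I) :
  functor (ho (sslice_hom i j)) (slice_hom (K := hstar S) proj i j) :=
  @fibre_lift _ _ _ (postcomp (K := hstar S) (dom i) (proj j)) (proj i)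
    (ho_map (sfibre_incl (spostcomp (dom i) (proj j)) (proj i)))
    (fun f => svalP f) (@canonical_subproof i j).

(** The canonical 2-functor [h_* (S/z) -> (h_* S)/z], the identity on objects and
    on 1-cells. *)
Definition canonical :
  two_functor (hstar slice_scat) (slice_two_cat (K := hstar S) proj).
Proof.
refine (@TwoFunctor (hstar slice_scat) (slice_two_cat (K := hstar S) proj) (fun i => i) canonical_hom _ _ _).
- by move=> i; apply: sval_eq.
- by move=> i j k g f; apply: sval_eq.
- by move=> i j k g g' f f' v u; apply: hom_eq_fibre; exact: ho2_nat.
Defined.
End SimplicialSlice.

Record qcat := QCat { qsset :> sset; qcatP : is_qcat qsset }.

Definition map_comp_simplex (A B C : sset) n (g : map_space B C n)
  (f : map_space A B n) : map_space A C n.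
Proof.
refine (@SMap (sprod A (simplex_std n)) C
  (fun k x => sfun g k (sfun f k x, x.2)) _).
by move=> k l a [x t]; rewrite -snat /= -snat.
Defined.

Definition map_comp (A B C : sset) :
  smap (sprod (map_space B C) (map_space A B)) (map_space A C).
Proof.
refine (@SMap (sprod (map_space B C) (map_space A B)) (map_space A C)
  (fun n x => map_comp_simplex x.1 x.2) _).
by move=> m n a [g f]; apply: smap_eq => k [x t].
Defined.

Lemma cst_map_vertex (A B : sset) (f : smap A B) n k
  (x : sprod A (simplex_std n) k) :
  sfun (cst n (map_vertex f) : map_space A B n) k x = f k x.1.
Proof. by case: n x. Qed.

Definition qCat_inf : scat.
Proof.
refine (@SCat qcat (fun A B => map_space A B)
  (fun A => map_vertex (smap_id A)) (fun A B C => map_comp A B C) _ _ _).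
- by move=> A B C D n h g f; apply: smap_eq => k [x t].
- by move=> A B n f; apply: smap_eq => k x; rewrite [LHS]cst_map_vertex.
- move=> A B n f; apply: smap_eq => k [x t].
  by congr (sfun f k (_, _)); exact: cst_map_vertex.
Defined.

(** Post-composition with [q : F -> A] is [q^E : F^E -> A^E]. *)
Lemma spostcomp_map (E F A : qcat) (q : smap F A) n (f : map_space E F n) k
  (x : sprod E (simplex_std n) k) :
  sfun (spostcomp (S := qCat_inf) E (b := F) (c := A) (map_vertex q) n f
          : map_space E A n) k x
  = q k (sfun f k x).
Proof. exact: cst_map_vertex. Qed.

Definition qCat_2 : two_cat := hstar qCat_inf.

Record isofib (A : qcat) := Isofib {
  idom : qcat;
  imap :> smap idom A;
  isofibP : is_isofib imap }.

Definition qCat_2_over (A : qcat) : two_cat :=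
  slice_two_cat (K := qCat_2) (z := A) (fun p : isofib A => map_vertex p).

Definition qCat_inf_over (A : qcat) : scat :=
  slice_scat (S := qCat_inf) (z := A) (fun p : isofib A => map_vertex p).

Definition canonical_over (A : qcat) :
    two_functor (hstar (qCat_inf_over A)) (qCat_2_over A) :=
  canonical (S := qCat_inf) (z := A) (fun p : isofib A => map_vertex p).

(* Main.v *)
(** An adjunction lifts along a 2-functor which is surjective on 1-cells and full
    on 2-cells, provided that the endo-2-cells over identities are invertible: lift the unit and a provisional counit; the first triangle
    composite lies over an identity, hence is invertible, and its inverse
    corrects the counit; the second triangle composite is then idempotent and
    again lies over an identity, hence is an identity.

    For the canonical 2-functor this is a statement on the fibres of the inner
    fibration [q^E : F^E -> A^E] between quasi-categories. Fullness is the
    lifting of a homotopy [q^E e ~ 1] along an inner 2-horn. For the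
    invertibility, an edge [h] of a fibre which becomes an identity in
    [h(F^E)] differs from the identity by a 2-sphere of [A^E], and lifting this
    sphere once more yields an inverse of [h].

    That [q^E] is an inner fibration is Joyal's argument: [Lambda^n_k -> Delta^n]
    is a retract of its corner product with [Lambda^2_1 -> Delta^2], and the
    corner product of any monomorphism with the latter is inner anodyne. *)

From mathcomp Require Import all_boot.
From mathcomp Require Import boolp classical_sets zify.
Require Import Defs.

Set Implicit Arguments.
Unset Strict Implicit.
Unset Printing Implicit Defensive.

(** * Extension by transfinite attachment *)

Definition sub_closed (X : sset) (P : forall n, X n -> Prop) :=
  forall m n (a : Delta m n) x, P n x -> P m (sact a x).
Definition rel_closed (X : sset) (R : forall n, X n -> forall m, X m -> Prop)
    (P : forall n, X n -> Prop) :=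
  forall n x m y, R n x m y -> P n x -> P m y.
Definition image_or (K Y : sset) (k : smap K Y) (M : forall n, Y n -> Prop) n y :=
  M n y \/ exists x : K n, k n x = y.

(** [M] together with the image of [k] is the pushout of [K] along [H -> M].
    The relation [R] records an invariant of the stages [M] of a filtration, in
    a form preserved by unions. *)
Definition attaches (E B : sset) (p : smap E B) (Y : sset)
    (R : forall n, Y n -> forall m, Y m -> Prop) (M : forall n, Y n -> Prop) :=
  exists (K : sset) (H : forall n, K n -> Prop) (HA : sub_closed H)
    (k : smap K Y),
  [/\ rlp (subsset_incl HA) p,
      forall n x, H n x <-> M n (k n x),
      forall n x x', ~ H n x -> k n x = k n x' -> x = x',
      rel_closed R (image_or k M) &
      exists n x, ~ M n (k n x)].

Section Extension.
Context (E B : sset) (p : smap E B) (Y : sset) (X : forall n, Y n -> Prop)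
  (XA : sub_closed X) (R : forall n, Y n -> forall m, Y m -> Prop).
Hypothesis XR : rel_closed R X.
Hypothesis attach : forall M : (forall n, Y n -> Prop),
  sub_closed M -> rel_closed R M -> (forall n y, X y -> M n y) ->
  ~ (forall n y, M n y) -> attaches p R M.
Context (u : smap (subsset XA) E) (v : smap Y B).
Hypothesis uv : p \os u = v \os subsset_incl XA.

Let T := {n : nat & (Y n * E n)%type}.
(** The graph of [u] is adjoined to [S] rather than required to lie in it, so that the empty set is
    admissible, as the union of the empty chain has to be. *)
Let graph (S : set T) n (y : Y n) (e : E n) : Prop :=
  (exists x : subsset XA n, sval x = y /\ u n x = e) \/ S (existT _ n (y, e)).
Let dom (S : set T) n (y : Y n) := exists e, graph S y e.

Let good (S : set T) :=
  [/\ forall m n (a : Delta m n) y e, graph S y e ->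
        graph S (sact a y) (sact a e),
      forall n (y : Y n) e e', graph S y e -> graph S y e' -> e = e',
      forall n (y : Y n) e, graph S y e -> p n e = v n y &
      rel_closed R (@dom S)].

Let graphW (S S' : set T) n (y : Y n) e :
  (S `<=` S')%classic -> graph S y e -> graph S' y e.
Proof. by move=> SS [?|/SS ?]; [left|right]. Qed.

(** Each condition concerns at most two points of the graph, and any two points of the union lie in
    the graph of one member of the chain or both in that of [u]. *)
Let good_union (F : set (set T)) : (F `<=` good)%classic ->
  total_on F subset -> good (\bigcup_(S in F) S)%classic.
Proof.
move=> FG Ft.
have inv n (y : Y n) e : graph (\bigcup_(S in F) S)%classic y e ->
    (exists x : subsset XA n, sval x = y /\ u n x = e) \/
    (exists2 S, F S & graph S y e).
  by case=> [|[S FS Sy]]; [left|right; exists S => //; right].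
have sub S : F S -> (S `<=` \bigcup_(S in F) S)%classic.
  by move=> FS t St; exists S.
have two n (y y' : Y n) e e' : graph (\bigcup_(S in F) S)%classic y e ->
    graph (\bigcup_(S in F) S)%classic y' e' ->
    (exists S, [/\ F S, graph S y e & graph S y' e']) \/
    (exists x x' : subsset XA n, [/\ sval x = y, u n x = e,
       sval x' = y' & u n x' = e']).
  move=> /inv [[x [xy xe]]|[S FS Sy]] /inv [[x' [xy' xe']]|[S' FS' Sy']].
  - by right; exists x, x'.
  - by left; exists S'; split => //; left; exists x.
  - by left; exists S; split => //; left; exists x'.
  - left; case: (Ft S S' FS FS') => SS.
      by exists S'; split => //; apply: graphW Sy.
    by exists S; split => //; apply: graphW Sy'.
split.
- move=> m n a y e /inv [[x [xy xe]]|[S FS Sy]].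
    by left; exists (sact a x); rewrite snat -xe -xy.
  by have [GA _ _ _] := FG S FS; apply: (graphW (sub _ FS)); apply: GA.
- move=> n y e e' h1 h2; case: (two _ _ _ _ _ h1 h2).
    by case=> S [FS]; have [_ GF _ _] := FG S FS; apply: GF.
  case=> x [x' [xy <- xy' <-]]; congr (u n _); apply: sval_eq; congruence.
- move=> n y e /inv [[x [xy xe]]|[S FS Sy]].
    by rewrite -xe -xy; have := congr1 (fun f : smap _ _ => f n x) uv.
  by have [_ _ GP _] := FG S FS; apply: GP.
- move=> n y m z Ryz [e /inv [[x [xy xe]]|[S FS Sy]]].
    have xz : X z by apply: XR Ryz _; rewrite -xy; exact: svalP.
    by exists (u m (exist _ z xz)); left; exists (exist _ z xz).
  have [_ _ _ GR] := FG S FS.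
  have [|e' h] := GR _ _ _ _ Ryz; first by exists e.
  by exists e'; apply: graphW h; apply: sub.
Qed.

(** A maximal partial lift is total: otherwise attach [K] to its domain and lift along [H]; the
    union of the two graphs is strictly larger. *)
Lemma extension_exists : exists l : smap Y E, l \os subsset_incl XA = u /\ p \os l = v.
Proof.
have [S [Sg Smax]] := Zorn_bigcup good_union.
have [GA GF GP GR] := Sg.
have XM n (y : Y n) (xy : X y) : graph S y (u n (exist _ y xy)).
  by left; exists (exist _ y xy).
have total : forall n (y : Y n), dom S y.
  apply: contrapT => nt.
  have MA : sub_closed (@dom S).
    by move=> m n a y [e h]; exists (sact a e); apply: GA.
  have [|K [H [HA [k [lif HM inj kR [n0 [x0 nx0]]]]]]] := attach MA GR _ nt.
    by move=> n y xy; exists (u n (exist _ y xy)).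
  (* The partial lift restricted along [k]; it is simplicial because the graph is single-valued. *)
  pose w n (x : subsset HA n) : E n := sval (cid ((HM n (sval x)).1 (svalP x))).
  have wP n x : graph S (k n (sval x)) (w n x).
    by rewrite /w; case: cid.
  have wN m n (a : Delta m n) x : w m (sact a x) = sact a (w n x).
    apply: GF (wP _ _) _; rewrite /= snat; exact/GA/wP.
  have [|l [lw lp]] := lif (SMap wN) (v \os k).
    by apply: smap_eq => n x /=; apply: GP.
  have lH n (x : K n) : H n x -> graph S (k n x) (l n x).
    move=> hx; have := congr1 (fun f : smap (subsset HA) E => f n (exist (H n) x hx)) lw.
    by move=> /= ->; exact: (wP _ (exist _ x hx)).
  (* The enlarged graph stays single-valued: [l] agrees with the old graph on [H], and [k]
     identifies nothing off [H]. *)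
  pose S' : set T := fun t =>
    S t \/ exists x : K (projT1 t), (k _ x, l _ x) = projT2 t.
  have inv n (y : Y n) e : graph S' y e <->
      graph S y e \/ exists x : K n, k n x = y /\ l n x = e.
    split=> [[h|[h|[x [<- <-]]]]|[[h|h]|[x [<- <-]]]].
    - by left; left.
    - by left; right.
    - by right; exists x.
    - by left.
    - by right; left.
    - by right; right; exists x.
  have S'g : good S'.
    split.
    - move=> m n a y e /inv [h|[x [<- <-]]]; apply/inv; first by left; apply: GA.
      by right; exists (sact a x); rewrite !snat.
    - have aux n (x : K n) e : graph S (k n x) e -> l n x = e.
        by move=> h; apply: (GF _ _ _ _ (lH _ _ _) h); apply/HM; exists e.
      move=> n y e e' /inv [h|[x [<- <-]]] /inv [h'|[x' [xx <-]]].
      + exact: GF h h'.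
      + by rewrite -xx in h; rewrite (aux _ _ _ h).
      + exact: aux.
      + case: (pselect (H n x')) => hx; last by rewrite (inj _ _ _ hx xx).
        by apply: aux; rewrite -xx; apply: lH.
    - move=> n y e /inv [/GP //|[x [<- <-]]].
      by have := congr1 (fun f : smap _ _ => f n x) lp.
    - move=> n y m z Ryz [e he]; have : image_or k (@dom S) z.
        apply: kR Ryz _; case/inv: he => [h|[x [<- _]]]; first by left; exists e.
        by right; exists x.
      case=> [[e' h]|[x <-]]; first by exists e'; apply/inv; left.
      by exists (l m x); apply/inv; right; exists x.
  apply: (Smax S') => //; split; first by move=> t; left.
  move=> S'S; apply: nx0; exists (l n0 x0); right; apply: S'S; right.
  by exists x0.
pose l n (y : Y n) := sval (cid (total n y)).
have lP n y : graph S y (l n y) by rewrite /l; case: cid.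
have lN m n (a : Delta m n) y : l m (sact a y) = sact a (l n y).
  by apply: GF (lP _ _) _; apply/GA/lP.
exists (SMap lN); split; apply: smap_eq => n y /=.
  case: y => y xy /=; exact: GF (lP _ _) (XM _ _ _).
exact: GP.
Qed.

End Extension.

(** By Zorn's lemma on the graphs of the partial lifts with [R]-closed domain. *)
Lemma rlp_attach (E B : sset) (p : smap E B) (Y : sset)
  (X : forall n, Y n -> Prop) (XA : sub_closed X)
  (R : forall n, Y n -> forall m, Y m -> Prop) :
  rel_closed R X ->
  (forall M : (forall n, Y n -> Prop),
    sub_closed M -> rel_closed R M -> (forall n y, X n y -> M n y) ->
    ~ (forall n y, M n y) -> attaches p R M) ->
  rlp (subsset_incl XA) p.
Proof. by move=> XR att u v uv; exact: (extension_exists XR att uv). Qed.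

(** * Monotone maps *)

(** Values of a monotone map, indexed by [nat] (junk beyond the source). *)
Definition dv m n (a : Delta m n) (i : nat) : nat := a (inord i).

Lemma dv_ord m n (a : Delta m n) (i : 'I_m.+1) : dv a i = a i.
Proof. by rewrite /dv inord_val. Qed.

Lemma dv_le m n (a : Delta m n) i : dv a i <= n.
Proof. by rewrite -ltnS ltn_ord. Qed.

Lemma dv_mono m n (a : Delta m n) i j : i <= j -> j <= m -> dv a i <= dv a j.
Proof. by move=> ij jm; apply: dfun_mono; rewrite !inordK //; lia. Qed.

Lemma dv_eq m n (a b : Delta m n) :
  (forall i, i <= m -> dv a i = dv b i) -> a = b.
Proof.
move=> e; apply: delta_eq => i; apply: val_inj; rewrite /= -!dv_ord.
by apply: e; rewrite -ltnS.
Qed.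

Lemma dv_comp k m n (a : Delta m n) (b : Delta k m) i :
  dv (dcomp a b) i = dv a (dv b i).
Proof. by rewrite {1}/dv mk_deltaE -dv_ord. Qed.

Lemma dcompA k l m n (a : Delta m n) (b : Delta l m) (c : Delta k l) :
  dcomp a (dcomp b c) = dcomp (dcomp a b) c.
Proof. by apply: dv_eq => i _; rewrite !dv_comp. Qed.

Lemma dv_id n i : i <= n -> dv (did n) i = i.
Proof. by move=> h; rewrite /dv mk_deltaE inordK. Qed.

Lemma dnat_subproof m n (f : nat -> nat)
  (fm : forall i j, i <= j -> j <= m -> f i <= f j) (i j : 'I_m.+1) :
  i <= j -> (inord (minn n (f i)) : 'I_n.+1) <= (inord (minn n (f j)) : 'I_n.+1).
Proof.
move=> ij; have := fm i j ij; rewrite -ltnS ltn_ord => /(_ isT).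
by rewrite !inordK; lia.
Qed.

Definition dnat m n (f : nat -> nat)
  (fm : forall i j, i <= j -> j <= m -> f i <= f j) : Delta m n :=
  mk_delta (@dnat_subproof m n f fm).

Lemma dv_dnat m n f fm i : i <= m -> f i <= n -> dv (@dnat m n f fm) i = f i.
Proof. by move=> im fn; rewrite /dv mk_deltaE inordK ?inordK; lia. Qed.

Lemma dface_subproof n k i j : i <= j -> j <= n -> bump k i <= bump k j.
Proof. by rewrite /bump; lia. Qed.

Definition dface n k : Delta n n.+1 := dnat n.+1 (@dface_subproof n k).

Lemma dv_face n k i : i <= n -> dv (dface n k) i = bump k i.
Proof. by move=> h; rewrite dv_dnat // /bump; lia. Qed.

Lemma ddeg_subproof n k i j : i <= j -> j <= n.+1 -> unbump k i <= unbump k j.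
Proof. by rewrite /unbump; lia. Qed.

Definition ddeg n k : Delta n.+1 n := dnat n (@ddeg_subproof n k).

Lemma dv_deg n k i : k <= n -> i <= n.+1 -> dv (ddeg n k) i = unbump k i.
Proof. by move=> h h'; rewrite dv_dnat // /unbump; lia. Qed.

(** Preimages under a monotone [b] of strictly increasing values can only increase, so any choice
    [f] of them is monotone. *)
Lemma delta_lift l m n (d : Delta l n) (b : Delta m n) (f : nat -> nat) :
  (forall i j, i < j -> j <= l -> dv d i < dv d j) ->
  (forall i, i <= l -> f i <= m /\ dv b (f i) = dv d i) ->
  exists2 c : Delta l m, dcomp b c = d & forall i, i <= l -> dv c i = f i.
Proof.
move=> dinj fP.
have fm i j : i <= j -> j <= l -> f i <= f j.
  rewrite leq_eqVlt => /orP [/eqP -> //|ij jl].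
  rewrite leqNgt; apply/negP => fji.
  have [fi ei] := fP i (leq_trans (ltnW ij) jl); have [fj ej] := fP j jl.
  by have := dinj _ _ ij jl; have := dv_mono b (ltnW fji) fi; lia.
have cf i : i <= l -> dv (dnat m fm) i = f i.
  by move=> il; have [fi _] := fP i il; rewrite dv_dnat.
exists (dnat m fm) => //; apply: dv_eq => i il.
by rewrite dv_comp cf //; have [] := fP i il.
Qed.

Lemma delta_choice l m n (d : Delta l n) (b : Delta m n) :
  (forall i, i <= l -> exists2 j, j <= m & dv b j = dv d i) ->
  exists f : nat -> nat, forall i, i <= l -> f i <= m /\ dv b (f i) = dv d i.
Proof.
move=> dim.
have dim' i : exists j, i <= l -> j <= m /\ dv b j = dv d i.
  case: (leqP i l) => il; last by exists 0.
  by have [j jm e] := dim i il; exists j.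
by exists (fun i => sval (cid (dim' i))) => i il; case: cid => /= j; apply.
Qed.

Lemma delta_factor l m n (d : Delta l n) (b : Delta m n) :
  (forall i j, i < j -> j <= l -> dv d i < dv d j) ->
  (forall i, i <= l -> exists2 j, j <= m & dv b j = dv d i) ->
  exists c : Delta l m, dcomp b c = d.
Proof.
by move=> dinj /delta_choice [f fP]; have [c] := delta_lift dinj fP; exists c.
Qed.

(** The bounds count the distinct values below and above the one at [i]. They serve to bound
    dimensions and to recognize identities. *)
Lemma delta_strict m n (a : Delta m n) :
  (forall i j, i < j -> j <= m -> dv a i < dv a j) ->
  forall i, i <= m -> i <= dv a i /\ dv a i + (m - i) <= n.
Proof.
move=> h i im; split; first by elim: i im => [//|i IH] im; have := h i i.+1; lia.
have [j ej] : exists j, j = m - i by exists (m - i).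
elim: j i im ej => [|j IH] i im ej; first by have := dv_le a i; lia.
by have := IH i.+1; have := h i i.+1; lia.
Qed.

(** A degeneracy retracts the face inclusion. The [minn] covers the last face [k = n.+1], for which
    there is no degeneracy of index [k]. *)
Lemma delta_miss m n (a : Delta m n.+1) k :
  k <= n.+1 -> (forall j, j <= m -> dv a j != k) ->
  exists c : Delta m n, dcomp (dface n k) c = a.
Proof.
move=> kn miss; exists (dcomp (ddeg n (minn k n)) a); apply: dv_eq => i im.
rewrite !dv_comp dv_deg ?dv_le //; last by lia.
by rewrite dv_face /unbump /bump; have := miss i im; have := dv_le a i; lia.
Qed.

Lemma horn_predE n (k : 'I_n.+1) m (a : simplex_std n m) :
  horn_pred k a <-> exists i, [/\ i <= n, i <> k & forall j, j <= m -> dv a j <> i].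
Proof.
split=> [[i ik h]|[i [il ik h]]].
  exists i; split; first by rewrite -ltnS.
    by move=> e; move/eqP: ik; apply; apply: val_inj.
  by move=> j jm e; move/eqP: (h (inord j)); apply; apply: val_inj; exact: e.
exists (inord i); first by apply/eqP => e; apply: ik; rewrite -e inordK.
move=> j; apply/eqP => e; apply: (h j); first by rewrite -ltnS.
by rewrite dv_ord e inordK.
Qed.

(** A simplex outside the horn hits every vertex except possibly [k], so a choice of preimages
    exhibits the missing face as a restriction of [b]. *)
Lemma not_horn_factor n (k : 'I_n.+2) m (b : Delta m n.+1) :
  ~ horn_pred k (b : simplex_std n.+1 m) ->
  exists c : Delta n m, dcomp b c = dface n k.
Proof.
move=> nh; apply: delta_factor => [i j ij jn|i ii].
  by rewrite !dv_face //; [rewrite /bump; lia|lia].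
apply: contrapT => h; apply: nh; apply/horn_predE.
exists (bump k i); split; first by rewrite /bump; lia.
  by apply/eqP; rewrite eq_sym neq_bump.
by move=> j jm e; apply: h; exists j; rewrite ?dv_face.
Qed.

Lemma min_nat (P : nat -> Prop) :
  (exists n, P n) -> exists2 n, P n & forall k, P k -> n <= k.
Proof.
move=> [n0 Pn0]; have ex : exists n, `[< P n >] by exists n0; apply/asboolP.
exists (ex_minn ex); first by case: ex_minnP => m /asboolP.
by move=> k /asboolP Pk; case: ex_minnP => m _; apply.
Qed.

Definition inner_fib (E B : sset) (p : smap E B) : Prop :=
  forall n (k : 'I_n.+1), 0 < k < n -> rlp (horn_incl k) p.

Lemma simplex_map_subproof (X : sset) n (x : X n) k l (a : Delta k l)
  (b : simplex_std n l) :
  sact (sact a b : simplex_std n k) x = sact a (sact b x).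
Proof. by rewrite -sactM. Qed.

Definition simplex_map (X : sset) n (x : X n) : smap (simplex_std n) X :=
  @SMap (simplex_std n) X (fun m a => sact a x) (simplex_map_subproof x).

Definition sprod_map (X X' Z Z' : sset) (f : smap X Z) (g : smap X' Z') :
  smap (sprod X X') (sprod Z Z').
Proof.
refine (@SMap (sprod X X') (sprod Z Z') (fun n x => (f n x.1, g n x.2)) _).
by move=> k n a x; rewrite /= !snat.
Defined.

(** * The corner product of a subobject with the inner 2-horn *)

Definition horn21_pred m (s : simplex_std 2 m) : Prop :=
  (forall j, j <= m -> dv s j != 0) \/ (forall j, j <= m -> dv s j != 2).

Lemma horn21_act : sub_closed (X := simplex_std 2) horn21_pred.
Proof.
move=> m n a s [h|h]; [left|right] => j jm; rewrite /= dv_comp; apply: h;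
  exact: dv_le.
Qed.

Definition boundary_pred n m (a : simplex_std n m) : Prop :=
  exists2 i, i <= n & forall j, j <= m -> dv a j != i.

Lemma boundary_act n : sub_closed (X := simplex_std n) (@boundary_pred n).
Proof.
move=> m k a s [i il h]; exists i => // j jm; rewrite /= dv_comp; apply: h.
exact: dv_le.
Qed.

Section Corner.
Variable m : nat.
Local Notation Y := (sprod (simplex_std m) (simplex_std 2)).

Definition corner_pred n (y : Y n) : Prop :=
  boundary_pred y.1 \/ horn21_pred y.2.

Lemma corner_act : sub_closed corner_pred.
Proof.
by move=> k n a y [h|h]; [left; apply: boundary_act|right; apply: horn21_act].
Qed.

Definition col n (y : Y n) i := dv y.1 i.
Definition row n (y : Y n) i := dv y.2 i.

Definition nondeg n (y : Y n) :=
  forall i, i < n -> col y i < col y i.+1 \/ row y i < row y i.+1.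

(** The nondegenerate simplices [y] outside the corner are paired by adding or
    removing the vertex [(c, 1)], for [(c, 0)] the last vertex of [y] in the
    row [0]; [topped y r] says that this vertex is present, in position [r + 1]. *)
Definition topped n (y : Y n) r :=
  [/\ r < n, row y r = 0, row y r.+1 = 1, col y r.+1 = col y r &
      nondeg y /\ ~ corner_pred y].

(** The relation goes from the simplex with the vertex removed to the topped one; the converse
    direction is closure under faces. *)
Inductive paired : forall n : nat, Y n -> forall k : nat, Y k -> Prop :=
| Paired n (y : Y n.+1) r : topped y r -> paired (sact (dface n r.+1) y) y.

Lemma colM n (y : Y n) i j : i <= j -> j <= n -> col y i <= col y j.
Proof. exact: dv_mono. Qed.
Lemma rowM n (y : Y n) i j : i <= j -> j <= n -> row y i <= row y j.
Proof. exact: dv_mono. Qed.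
Lemma row2 n (y : Y n) i : row y i <= 2.
Proof. exact: dv_le. Qed.
Lemma colm n (y : Y n) i : col y i <= m.
Proof. exact: dv_le. Qed.

Lemma col_act k n (a : Delta k n) (y : Y n) i : col (sact a y) i = col y (dv a i).
Proof. exact: dv_comp. Qed.
Lemma row_act k n (a : Delta k n) (y : Y n) i : row (sact a y) i = row y (dv a i).
Proof. exact: dv_comp. Qed.

Lemma Yeq n (y y' : Y n) :
  (forall i, i <= n -> col y i = col y' i /\ row y i = row y' i) -> y = y'.
Proof.
case: y y' => [a s] [a' s'] h; congr (_, _); apply: dv_eq => i im;
  by case: (h i im).
Qed.

Lemma nondeg_inj n (y : Y n) i j : nondeg y -> i < j -> j <= n ->
  col y i < col y j \/ row y i < row y j.
Proof.
move=> nd ij jn; have h1 := colM y ij jn; have h2 := rowM y ij jn.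
by case: (nd i); lia.
Qed.

Lemma ncorner_col n (y : Y n) : ~ corner_pred y ->
  forall i, i <= m -> exists2 j, j <= n & col y j = i.
Proof.
move=> nc i im; apply: contrapT => h; apply: nc; left; exists i => // j jn.
by apply/eqP => e; apply: h; exists j.
Qed.

Lemma ncorner_row0 n (y : Y n) : ~ corner_pred y -> row y 0 = 0.
Proof.
move=> nc; apply: contrapT => h; apply: nc; right; left => j jn.
by have := rowM y (leq0n j) jn; rewrite /row in h *; lia.
Qed.

Lemma ncorner_row2 n (y : Y n) : ~ corner_pred y -> row y n = 2.
Proof.
move=> nc; apply: contrapT => h; apply: nc; right; right => j jn.
by have := rowM y jn (leqnn n); have := row2 y n; rewrite /row in h *; lia.
Qed.

(** The last vertex lies in the row [2], so the added vertex is not the last one: this makes the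
    horns to be filled inner. *)
Lemma topped_lt n (y : Y n) r : topped y r -> r.+1 < n.
Proof.
case=> rn _ r1 _ [_ /ncorner_row2 e]; rewrite ltn_neqAle rn andbT.
by apply/eqP => e'; rewrite e' e in r1.
Qed.

Lemma topped_inj n (y : Y n) (r : nat) i j : topped y r -> i <= n -> j <= n ->
  col y i = col y j -> row y i = row y j -> i = j.
Proof.
case=> _ _ _ _ [nd _] im jn ec er.
case: (ltngtP i j) => // ij.
  by have := nondeg_inj nd ij jn; lia.
by have := nondeg_inj nd ij im; lia.
Qed.

Lemma act_inj n (y : Y n) r k (a b : Delta k n) : topped y r ->
  sact a y = sact b y -> a = b.
Proof.
move=> ty e; apply: dv_eq => i ik.
apply: (topped_inj ty (dv_le _ _) (dv_le _ _)).
  by rewrite -!col_act e.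
by rewrite -!row_act e.
Qed.

Lemma face_hit n k j : j <= n.+1 -> j != k -> k <= n.+1 ->
  unbump k j <= n /\ dv (dface n k) (unbump k j) = j.
Proof.
move=> jn jk kn; have h : unbump k j <= n by move: jk; rewrite /unbump; lia.
by split=> //; rewrite dv_face // unbumpKcond (negPf jk).
Qed.

(** Removing the added vertex loses no column, since the position [r] lies in the same one, and
    leaves vertices in the rows [0] and [2]. Thus the face is outside the corner too. *)
Lemma paired_corner : rel_closed paired corner_pred.
Proof.
move=> n y0 k y1 [] {y0 y1} {}n y r ty; have rn := topped_lt ty.
case: ty => _ r0 r1 ec [_ nc] [[i im h]|[h|h]].
- have [j jn ej] := ncorner_col nc im.
  have [jr|jr] := eqVneq j r.+1.
    have [|||h1 h2] := @face_hit n r.+1 r; try lia.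
    move: (h _ h1); rewrite /= -/(col _ _) dv_comp h2 -/(col y r) -ec -jr ej.
    by rewrite eqxx.
  have [|||h1 h2] := @face_hit n r.+1 j; try lia.
  by move: (h _ h1); rewrite /= dv_comp h2 -/(col y j) ej eqxx.
- have [|||h1 h2] := @face_hit n r.+1 r; try lia.
  by move: (h _ h1); rewrite /= dv_comp h2 -/(row y r) r0.
- have [|||h1 h2] := @face_hit n r.+1 n.+1; try lia.
  by move: (h _ h1); rewrite /= dv_comp h2 -/(row y _) ncorner_row2.
Qed.

(** [y] with the vertex [(col y r, 1)] inserted after the position [r]. *)
Lemma insert_subproof n (y : Y n) r (r0 : row y r = 0) (rn : r < n)
  (r1 : 0 < row y r.+1) i j : i <= j -> j <= n.+1 ->
  (if i == r.+1 then col y r else col y (unbump r.+1 i))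
    <= (if j == r.+1 then col y r else col y (unbump r.+1 j)) /\
  (if i == r.+1 then 1 else row y (unbump r.+1 i))
    <= (if j == r.+1 then 1 else row y (unbump r.+1 j)).
Proof.
move=> ij jn.
have M a b : a <= b -> b <= n -> col y a <= col y b /\ row y a <= row y b.
  by move=> ab bn; split; [exact: colM|exact: rowM].
case: (altP (i =P r.+1)) => [ei|ni]; case: (altP (j =P r.+1)) => [ej|nj] //.
- have := M r (unbump r.+1 j); have := M r.+1 (unbump r.+1 j).
  by rewrite /unbump; lia.
- have := M (unbump r.+1 i) r; have := M (unbump r.+1 i) r.
  by rewrite /unbump; lia.
- by apply: M; rewrite /unbump; lia.
Qed.

(** The last hypothesis says that the vertex to be inserted is not already present, which keeps the
    result nondegenerate. *)
Lemma insert_exists n (y : Y n) r : row y r = 0 -> r < n -> 0 < row y r.+1 ->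
  nondeg y -> ~ corner_pred y -> (row y r.+1 = 1 -> col y r <> col y r.+1) ->
  exists2 z : Y n.+1, topped z r & sact (dface n r.+1) z = y.
Proof.
move=> r0 rn r1 nd nc ne.
have f i j ij jn := @insert_subproof n y r r0 rn r1 i j ij jn.
pose z : Y n.+1 := (dnat m (fun i j ij jn => proj1 (f i j ij jn)),
                    dnat 2 (fun i j ij jn => proj2 (f i j ij jn))).
have zc i : i <= n.+1 ->
    col z i = if i == r.+1 then col y r else col y (unbump r.+1 i).
  by move=> ii; rewrite /col dv_dnat //; case: ifP => _; exact: colm.
have zr i : i <= n.+1 ->
    row z i = if i == r.+1 then 1 else row y (unbump r.+1 i).
  by move=> ii; rewrite /row dv_dnat //; case: ifP => // _; exact: row2.
have zy : sact (dface n r.+1) z = y.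
  apply: Yeq => i ii.
  rewrite col_act row_act dv_face // zc ?zr; try by rewrite /bump; lia.
  by rewrite bumpK eq_sym (negPf (neq_bump _ _)).
have ub : unbump r.+1 r = r by rewrite /unbump; lia.
exists z => //; split; first lia.
- by rewrite zr ?ltn_eqF ?ub //; lia.
- by rewrite zr ?eqxx //; lia.
- rewrite !zc ?eqxx; try lia.
  by rewrite ltn_eqF // ub.
split; last first.
  by move=> h; apply: nc; rewrite -zy; apply: corner_act.
move=> i ii; rewrite !zc ?zr; try lia.
rewrite /unbump.
have [ir|ir|ir] := ltngtP i r.
- have -> : (i == r.+1) = false by lia.
  have -> : (i.+1 == r.+1) = false by lia.
  have -> : r.+1 < i = false by lia.
  have -> : r.+1 < i.+1 = false by lia.
  by rewrite !subn0; apply: nd; lia.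
- have -> : (i.+1 == r.+1) = false by lia.
  have -> : r.+1 < i.+1 by lia.
  have [->|ne'] := eqVneq i r.+1.
    by have := colM y (leqnSn r) rn; rewrite subn1 /=; lia.
  have -> : r.+1 < i by lia.
  have := nd i.-1; rewrite prednK ?subn1; last lia.
  by apply; lia.
- by rewrite ir eqxx ltn_eqF // -/(unbump _ _) ub r0; right.
Qed.

Lemma ncorner_nondeg_diag n (y : Y n) r : nondeg y -> ~ corner_pred y ->
  row y r = 0 -> r <= n -> forall j, j < r -> col y j < col y r.
Proof.
move=> nd nc r0 rn j jr; have := nondeg_inj nd jr rn.
by have := rowM y (ltnW jr) rn; lia.
Qed.

(** The removal of the added vertex determines a topped simplex, since it
    determines the last position in the row [0]. *)
Lemma topped_face_inj n (y z : Y n.+1) r t : topped y r -> topped z t ->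
  sact (dface n r.+1) y = sact (dface n t.+1) z -> y = z.
Proof.
move=> ty tz e; have rn := topped_lt ty; have tn := topped_lt tz.
case: ty tz => _ y0 y1 yc [ynd _] [_ z0 z1 zc [znd _]].
have E i : i <= n ->
    col y (bump r.+1 i) = col z (bump t.+1 i) /\
    row y (bump r.+1 i) = row z (bump t.+1 i).
  by move=> ii; rewrite -!(dv_face _ ii) -!col_act -!row_act e.
have rt : r = t.
  case: (ltngtP r t) => // h.
    have [|_] := E r.+1; first lia.
    have -> : bump r.+1 r.+1 = r.+2 by rewrite /bump; lia.
    have -> : bump t.+1 r.+1 = r.+1 by rewrite /bump; lia.
    have := rowM y (leqnSn r.+1); have := rowM z (i := r.+1) (j := t) h.
    lia.
  have [|_] := E t.+1; first lia.
  have -> : bump t.+1 t.+1 = t.+2 by rewrite /bump; lia.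
  have -> : bump r.+1 t.+1 = t.+1 by rewrite /bump; lia.
  have := rowM z (leqnSn t.+1); have := rowM y (i := t.+1) (j := r) h.
  lia.
case: t / rt z0 z1 zc E {e tn} => z0 z1 zc E.
have E' i : i <= n.+1 -> i <> r.+1 -> col y i = col z i /\ row y i = row z i.
  move=> ii ne; have := E (unbump r.+1 i); rewrite unbumpKcond.
  have -> : (i == r.+1) = false by apply/eqP.
  by apply; rewrite /unbump; lia.
apply: Yeq => i ii; have [->|/eqP ne] := eqVneq i r.+1; last exact: E'.
by have [||e1 e2] := E' r; [lia|lia|]; rewrite yc zc y1 z1 e1.
Qed.

(** The two halves of the pairing are disjoint: the vertices of a nondegenerate simplex are
    distinct, so once the added vertex is removed it does not occur again. *)
Lemma topped_not_face n (y : Y n.+1) (z : Y n.+2) r t :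
  topped y r -> topped z t -> sact (dface n.+1 t.+1) z <> y.
Proof.
move=> ty tz e; have rn := topped_lt ty; have tn := topped_lt tz.
case: ty tz => _ y0 y1 yc _ [_ z0 z1 zc [znd _]].
have E i : i <= n.+1 ->
    col y i = col z (bump t.+1 i) /\ row y i = row z (bump t.+1 i).
  by move=> ii; rewrite -!(dv_face _ ii) -!col_act -!row_act e.
have [|er ec] := E r; first lia.
have [|er' ec'] := E r.+1; first lia.
case: (ltngtP r t) => h.
- have eb : bump t.+1 r.+1 = r.+1 by rewrite /bump; lia.
  by have := rowM z (i := r.+1) (j := t) h; rewrite -eb -ec'; lia.
- have eb : t.+1 <= bump t.+1 r by rewrite /bump; lia.
  by have := rowM z eb; rewrite -ec /bump; lia.
have e1 : bump t.+1 r = t by rewrite /bump; lia.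
have e2 : bump t.+1 r.+1 = t.+2 by rewrite /bump; lia.
rewrite e1 in er ec; rewrite e2 in er' ec'.
by have := znd t.+1; lia.
Qed.

(** Take a simplex of least dimension outside [M]. It is topped, or else inserting the vertex gives
    a topped simplex, which is outside [M] because one of its faces is. *)
Lemma topped_exists (M : forall n, Y n -> Prop) : sub_closed M ->
  rel_closed paired M -> (forall n y, @corner_pred n y -> M n y) ->
  ~ (forall n y, M n y) ->
  exists n (y : Y n.+1) r, topped y r /\ ~ M _ y.
Proof.
move=> MA MR MX nM.
have [|n [y ny] min] := @min_nat (fun n => exists y : Y n, ~ M n y).
  apply: contrapT => h; apply: nM => n y; apply: contrapT => h'; apply: h.
  by exists n, y.
have nc : ~ corner_pred y by move/MX.
(* With two equal consecutive vertices [y] would be a degeneracy of its face [i], which lies in [M]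
   by minimality. *)
have nd : nondeg y.
  move=> i ii; apply: contrapT => h; case: n => [//|n] in y ny min nc ii h *.
  suff e : y = sact (ddeg n i) (sact (dface n i) y).
    apply: ny; rewrite e; apply: MA; apply: contrapT => h'.
    have /min : exists y : Y n, ~ M n y by exists (sact (dface n i) y).
    by rewrite ltnn.
  have [ec er] : col y i = col y i.+1 /\ row y i = row y i.+1.
    by have := colM y (leqnSn i) ii; have := rowM y (leqnSn i) ii; lia.
  apply: Yeq => j jn; rewrite !col_act !row_act dv_deg //.
  rewrite dv_face; last by rewrite /unbump; lia.
  rewrite unbumpKcond; case: eqP => [->|//].
  by rewrite ec er; split; congr (_ _ _); lia.
have [] : exists2 r, row y r = 0 & r < n /\ 0 < row y r.+1.
  (* The least position followed by a vertex off the row [0] is, by minimality, itself in the row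
     [0]. *)
  have [|r rn min'] := @min_nat (fun r => r < n /\ 0 < row y r.+1).
    have r0 := ncorner_row0 nc; have r2 := ncorner_row2 nc.
    have n0 : 0 < n.
      by rewrite ltnNge; apply/negP => h; have := rowM y h (leq0n n); lia.
    by exists n.-1; rewrite !prednK // r2; lia.
  exists r => //; case: r rn min' => [|r] rn min'; first exact: ncorner_row0.
  apply/eqP; rewrite -leqn0 leqNgt; apply/negP => h.
  have /min' : r < n /\ 0 < row y r.+1 by split=> //; case: rn; lia.
  by rewrite ltnn.
move=> r r0 [rn r1].
case: (pselect (row y r.+1 = 1 -> col y r <> col y r.+1)) =>
  [ne|/not_implyP [e1 /contrapT ec]].
  have [z tz zy] := insert_exists r0 rn r1 nd nc ne.
  by exists n, z, r; split=> // Mz; apply: ny; rewrite -zy; apply: MA.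
by case: n => [//|n] in y ny min nc nd r0 rn r1 e1 ec *; exists n, y, r; split.
Qed.

(** Attach the topped simplices by dimension, then by position of the last
    vertex in the row [0]. *)
Lemma corner_attach (E B : sset) (p : smap E B) : inner_fib p ->
  forall M : (forall n, Y n -> Prop), sub_closed M -> rel_closed paired M ->
  (forall n y, @corner_pred n y -> M n y) ->
  ~ (forall n y, M n y) -> attaches p paired M.
Proof.
move=> pI M MA MR MX nM.
have [|n [y0 [r0 [ty0 ny0]]] minn] := @min_nat (fun n =>
    exists (y : Y n.+1) r, topped y r /\ ~ M _ y).
  exact: topped_exists.
have [|r [y [ty ny]] minr] := @min_nat (fun r =>
    exists (y : Y n.+1), topped y r /\ ~ M _ y).
  by exists r0, y0.
have {}minn n' (z : Y n'.+1) t : topped z t -> ~ M _ z -> n <= n'.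
  by move=> tz nz; apply: minn; exists z, t.
have {}minr (z : Y n.+1) t : topped z t -> ~ M _ z -> r <= t.
  by move=> tz nz; apply: minr; exists z.
move=> {y0 r0 ty0 ny0}; have rn := topped_lt ty.
have [_ yr0 yr1 yc [nd nc]] := ty.
(* For [i < r] the column of the vertex [i] is lost, so the face lies in the corner. For [i > r.+1]
   a face outside the corner is still topped, in lower dimension. For [i = r] a face outside the
   corner becomes topped by an insertion at the position [r.-1], against the minimality of [r]. *)
have face i : i <= n.+1 -> i <> r.+1 -> M n (sact (dface n i) y).
  move=> ii ir; apply: contrapT => nf; set f := sact _ _ in nf.
  have ncf : ~ corner_pred f by move/MX.
  have fc j : j <= n -> col f j = col y (bump i j) by move=> h; rewrite col_act dv_face.
  have fr j : j <= n -> row f j = row y (bump i j) by move=> h; rewrite row_act dv_face.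
  case: (ltngtP i r) => hi.
  - have [j jn ej] := ncorner_col ncf (colm y i).
    rewrite fc // in ej; have hr := ncorner_nondeg_diag nd nc yr0 (ltnW (ltnW rn)) hi.
    have bi : bump i j != i by rewrite eq_sym neq_bump.
    case: (leqP (bump i j) r) => hb.
      have := @nondeg_inj _ y (bump i j) i nd; have := @nondeg_inj _ y i (bump i j) nd.
      have := rowM y hb; have := rowM y (ltnW hi); lia.
    have := colM y (ltnW hb); rewrite /bump in ej *; lia.
  - have hi' : r.+1 < i by lia.
    have tf : topped f r.
      have b1 : bump i r = r by rewrite /bump; lia.
      have b2 : bump i r.+1 = r.+1 by rewrite /bump; lia.
      split; first lia.
      - by rewrite fr ?b1 //; lia.
      - by rewrite fr ?b2 //; lia.
      - by rewrite !fc ?b1 ?b2 //; lia.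
      split=> // j jn; rewrite !fc ?fr; try lia.
      by apply: nondeg_inj nd _ _; rewrite /bump; lia.
    case: (n) minn f tf nf {ncf fc fr} rn => [|n1] minn f tf nf rn1; first lia.
    by have := minn _ _ _ tf nf; lia.
  - case: r => [|r] in ty ny minr rn yr0 yr1 yc ir hi *.
      have := ncorner_row0 ncf; rewrite fr // hi; rewrite -[bump 0 0]/1 yr1 //.
    have b1 : bump i r = r by rewrite /bump; lia.
    have b2 : bump i r.+1 = r.+2 by rewrite /bump; lia.
    have [||||||z tz zf] := @insert_exists _ f r;
      rewrite ?fr ?fc ?b1 ?b2 ?yr1 //; try lia.
    + by have := rowM y (leqnSn r); lia.
    + move=> j jn; rewrite !fc ?fr; try lia.
      by apply: nondeg_inj nd _ _; rewrite /bump; lia.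
    + have := ncorner_nondeg_diag nd nc yr0; rewrite yc => /(_ _ r); lia.
    have /minr : topped z r by [].
    suff nz : ~ M _ z by move/(_ nz); rewrite ltnn.
    by move=> Mz; apply: nf; rewrite -zf; apply: MA.
pose k : 'I_n.+2 := inord r.+1.
have kE : k = r.+1 :> nat by rewrite inordK //; lia.
pose K : smap (simplex_std n.+1) Y := simplex_map y.
(* A simplex outside the horn has the face [r.+1] as a restriction; were its image in [M], closure
   under [paired] would put [y] there. *)
have hornM j (b : simplex_std n.+1 j) : horn_pred k b <-> M j (K j b).
  split=> [/horn_predE [i [ii ik h]]|Mb].
    have [|c <-] := @delta_miss _ _ b i ii; first by move=> l lj; apply/eqP/h.
    rewrite -[K j _]/(sact _ y) sactM; apply: MA; apply: face => //; by rewrite -kE.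
  apply: contrapT => nh.
  have [c bc] := not_horn_factor nh.
  apply: ny; apply: (MR _ (sact (dface n r.+1) y)); first exact: Paired.
  by rewrite -kE -bc sactM; apply: MA.
exists (simplex_std n.+1), (@horn_pred _ k), (@horn_act _ k), K; split.
- by apply: pI; rewrite kE; lia.
- exact: hornM.
- by move=> j b b' _; exact: act_inj ty.
- move=> j z j' z' [] {j z j' z'} j z t tz [Mz|[b Kb]].
    by left; apply: MR Mz; exact: Paired.
  case: (pselect (horn_pred k b)) => [/hornM Mb|nh].
    by left; apply: (MR _ _ _ _ (Paired tz)); rewrite -Kb.
  right.
  (* The image of [b] is a face of a nondegenerate simplex, so [b] is injective, and it restricts to
     the face [k]: its dimension is [n] or [n.+1]. In dimension [n.+1] the topped [y] would be the
     face of a topped simplex; in dimension [n] the two topped simplices share their face, hence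
     coincide. *)
  have bs i l : i < l -> l <= j -> dv b i < dv b l.
    move=> il lj; rewrite ltn_neqAle dv_mono ?andbT ?(ltnW il) //.
    apply/eqP => eb.
    have hi : i <= j by lia.
    have := @topped_inj _ z t (bump t.+1 i) (bump t.+1 l) tz.
    have zE h : h <= j -> col z (bump t.+1 h) = col y (dv b h) /\
        row z (bump t.+1 h) = row y (dv b h).
      by move=> hj; rewrite -!(dv_face _ hj) -!col_act -!row_act -Kb.
    have [-> ->] := zE _ hi; have [-> ->] := zE _ lj.
    rewrite eb /bump; lia.
  have [c bc] := not_horn_factor nh.
  have cs i l : i < l -> l <= n -> dv c i < dv c l.
    move=> il ln; rewrite ltn_neqAle dv_mono ?andbT ?(ltnW il) //.
    apply/eqP => ec; have : dv (dcomp b c) i = dv (dcomp b c) l.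
      by rewrite !dv_comp ec.
    by rewrite bc !dv_face //; [rewrite /bump; lia|lia].
  have nj : n <= j by have := delta_strict cs (leqnn n); lia.
  have jn : j <= n.+1 by have := delta_strict bs (leq0n j); lia.
  move: jn; rewrite leq_eqVlt => /orP [/eqP ej|jn].
    move/esym: ej => ej; case: j / ej z t tz b Kb {nh c bc cs nj} bs => z t tz b Kb bs.
    case: (topped_not_face ty tz); rewrite -Kb.
    suff -> : b = did n.+1 by exact: sact1.
    by apply: dv_eq => i ii; rewrite dv_id //; have := delta_strict bs ii; lia.
  have {jn}ej : n = j by lia.
  case: j / ej z t tz b Kb {nh nj} bs c bc cs => z t tz b Kb bs c bc cs.
  have ec : c = did n.
    by apply: dv_eq => i ii; rewrite dv_id //; have := delta_strict cs ii; lia.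
  exists (did n.+1); apply: etrans (sact1 y) _; apply: topped_face_inj ty tz _.
  rewrite -Kb -kE -bc ec; congr (sact _ y); apply: dv_eq => i ii.
  by rewrite dv_comp dv_id.
- by exists n.+1, (did n.+1); rewrite -[K _ _]/(sact _ y) sact1.
Qed.
End Corner.

Lemma corner_rlp (E B : sset) (p : smap E B) m :
  inner_fib p -> rlp (subsset_incl (@corner_act m)) p.
Proof.
move=> pI; exact: (rlp_attach (@paired_corner m) (corner_attach pI)).
Qed.

(** * Reduction of an arbitrary subobject to boundary inclusions *)

Lemma not_boundary n m (b : Delta m n) : ~ boundary_pred (b : simplex_std n m) ->
  forall i, i <= n -> exists2 j, j <= m & dv b j = i.
Proof.
move=> h i il; apply: contrapT => h'; apply: h; exists i => // j jm.
by apply/eqP => e; apply: h'; exists j.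
Qed.

Lemma boundary_factor n m (b : Delta m n) : boundary_pred (b : simplex_std n m) ->
  exists k (d : Delta k n) (c : Delta m k), k < n /\ dcomp d c = b.
Proof.
case: n b => [|n] b [i ii h].
  by have := h 0 isT; have := dv_le b 0; lia.
by have [c e] := delta_miss ii h; exists n, (dface n i), c.
Qed.

(** Any choice of preimages is a section, so [i] may be prescribed as the preimage of its own
    value. *)
Lemma surj_section n m (b : Delta m n) i :
  ~ boundary_pred (b : simplex_std n m) -> i <= m ->
  exists2 c : Delta n m, dcomp b c = did n & dv c (dv b i) = i.
Proof.
move=> nb im; have [j jn|f fP] := @delta_choice n m n (did n) b.
  by rewrite dv_id //; apply: not_boundary.
pose g j := if j == dv b i then i else f j.
have [j k jk kn|j jn|c e cg] := @delta_lift n m n (did n) b g.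
- by rewrite !dv_id //; lia.
- by rewrite /g; case: eqP => [->|_]; [rewrite dv_id ?dv_le|exact: fP].
- by exists c => //; rewrite cg ?dv_le // /g eqxx.
Qed.

Lemma surj_id n (b : Delta n n) : ~ boundary_pred (b : simplex_std n n) -> b = did n.
Proof.
move=> nb; have [c e _] := surj_section nb (leq0n n).
have E j : j <= n -> dv b (dv c j) = j by move=> h; rewrite -dv_comp e dv_id.
have cs i j : i < j -> j <= n -> dv c i < dv c j.
  move=> ij jn; rewrite ltn_neqAle dv_mono ?(ltnW ij) // andbT.
  by apply/eqP => h; have := E i; have := E j jn; rewrite h; lia.
apply: dv_eq => j jn; rewrite dv_id // -[in LHS](_ : dv c j = j) ?E //.
by have := delta_strict cs jn; lia.
Qed.

Section Product.
Context (Z : sset) (W : forall n, Z n -> Prop) (WA : sub_closed W).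
Local Notation Y := (sprod Z (simplex_std 2)).

Definition pcorner_pred n (y : Y n) : Prop := W y.1 \/ horn21_pred y.2.

Lemma pcorner_act : sub_closed pcorner_pred.
Proof. by move=> k n a y [h|h]; [left; apply: WA|right; apply: horn21_act]. Qed.

(** A stage containing the corner and closed under this relation is the union of [Z x Lambda^2_1]
    and [W' x Delta^2] for a subobject [W'] of [Z]. *)
Inductive same_base : forall n : nat, Y n -> forall k : nat, Y k -> Prop :=
| SameBase n k (a : Delta k n) (z : Z n) (s : simplex_std 2 n)
    (t : simplex_std 2 k) :
    ~ horn21_pred s -> same_base (z, s) (sact a z, t).

Lemma same_base_pcorner : rel_closed same_base pcorner_pred.
Proof.
by move=> n y k y' [] {y y'} {}n {}k a z s t ns [h|//]; left; apply: WA.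
Qed.

(** Cell by cell: choose [z] of least dimension with [{z} x Delta^2] not contained in [M], and
    attach [Delta^n x Delta^2] along the corner over the boundary of [z]. *)
Lemma pcorner_attach (E B : sset) (p : smap E B) : inner_fib p ->
  forall M : (forall n, Y n -> Prop), sub_closed M -> rel_closed same_base M ->
  (forall n y, @pcorner_pred n y -> M n y) ->
  ~ (forall n y, M n y) -> attaches p same_base M.
Proof.
move=> pI M MA MR MX nM.
have [|n [z [m0 [a0 [t0 nz]]]] min] := @min_nat (fun n => exists (z : Z n) m
    (a : Delta m n) t, ~ M m (sact a z, t)).
  apply: contrapT => h; apply: nM => n [z s]; apply: contrapT => h'; apply: h.
  by exists n, z, n, (did n), s; rewrite sact1.
pose k : smap (sprod (simplex_std n) (simplex_std 2)) Y :=
  sprod_map (simplex_map z) (smap_id _).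
have base m (b : Delta m n) l (a : Delta l m) t :
    boundary_pred (b : simplex_std n m) -> M l (sact (dcomp b a) z, t).
  move=> /boundary_factor [n' [d [c [n'n <-]]]]; apply: contrapT => h.
  have : n <= n'; last by rewrite leqNgt n'n.
  by apply: min; exists (sact d z), l, (dcomp c a), t; rewrite -!sactM dcompA.
have low m (x : sprod (simplex_std n) (simplex_std 2) m) :
    corner_pred x -> M m (k m x).
  case: x => b t [h|h]; last by apply: MX; right.
  by have := base _ b _ (did m) t h; rewrite sactM sact1.
have high m (x : sprod (simplex_std n) (simplex_std 2) m) :
    ~ corner_pred x -> ~ M m (k m x).
  case: x => b t nc Mx; apply: nz.
  have [||c bc _] := @surj_section n m b 0 => //; first by move=> h; apply: nc; left.
  have -> : a0 = dcomp b (dcomp c a0).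
    by apply: dv_eq => i ii; rewrite !dv_comp -(dv_comp b c) bc dv_id // dv_le.
  by rewrite sactM; apply: MR Mx; constructor => h; apply: nc; right.
exists (sprod (simplex_std n) (simplex_std 2)), (@corner_pred n),
  (@corner_act n), k; split.
- exact: corner_rlp.
- move=> m x; split; first exact: low.
  by move=> Mx; apply: contrapT => /high.
- move=> m [b t] [b' t'] nc [e ->]; congr (_, _); apply: dv_eq => i im.
  have [||c bc ci] := @surj_section n m b i => //; first by move=> h; apply: nc; left.
  (* If this composite were in the boundary, minimality would put the missing simplex over [z] in
     [M]. So it is the identity, and since the section [c] passes through [i], the maps [b] and [b']
     agree at [i]. *)
  have /surj_id b'c : ~ boundary_pred (dcomp b' c : simplex_std n n).
    move=> /base h; apply: nz; have := h _ a0 t0.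
    by rewrite sactM sactM -e -(sactM b c) bc sact1.
  by rewrite -[in RHS]ci -dv_comp b'c dv_id ?dv_le.
- move=> m y m' y' [] {y y'} {}m {}m' a z' s t ns [h|[[b s'] [e1 e2]]].
    by left; apply: MR h; constructor.
  by right; exists (dcomp b a, t); rewrite /= -e1 sactM.
- by exists m0, (a0, t0).
Qed.

Lemma pcorner_rlp (E B : sset) (p : smap E B) :
  inner_fib p -> rlp (subsset_incl pcorner_act) p.
Proof.
move=> pI; exact: (rlp_attach same_base_pcorner (pcorner_attach pI)).
Qed.
End Product.

(** * Exponentials of inner fibrations *)

Section Retract.
Variables (n : nat) (k : 'I_n.+1).

(** The rows [0] and [2] truncate [i] at [k] from above and from below, and the row [1] is constant
    at [k]; [split_at] selects for each [i] a row in which [i] is fixed. *)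
Definition collapse_val (i t : nat) : nat :=
  if t == 0 then minn i k else if t == 1 then k : nat else maxn i k.

Lemma collapse_subproof m (a : Delta m n) (s : Delta m 2) i j :
  i <= j -> j <= m ->
  collapse_val (dv a i) (dv s i) <= collapse_val (dv a j) (dv s j).
Proof.
move=> ij jm; have := dv_mono a ij jm; have := dv_mono s ij jm.
rewrite /collapse_val; case: (dv s i) => [|[|x]]; case: (dv s j) => [|[|y]] //=; lia.
Qed.

Lemma collapse_val_le i t : i <= n -> collapse_val i t <= n.
Proof.
have : k <= n by rewrite -ltnS.
by rewrite /collapse_val; case: t => [|[|t]] /=; lia.
Qed.

Definition collapse_fun m (x : sprod (simplex_std n) (simplex_std 2) m) :
  simplex_std n m := dnat n (collapse_subproof x.1 x.2).

Lemma dv_collapse m (x : sprod (simplex_std n) (simplex_std 2) m) i : i <= m ->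
  dv (collapse_fun x) i = collapse_val (dv x.1 i) (dv x.2 i).
Proof. by move=> im; rewrite dv_dnat // collapse_val_le // dv_le. Qed.

Lemma collapse_nat m l (a : Delta m l) x :
  collapse_fun (sact a x) = sact a (collapse_fun x).
Proof.
by apply: dv_eq => i im; rewrite /= dv_comp !dv_collapse ?dv_le //= !dv_comp.
Qed.

Definition collapse : smap (sprod (simplex_std n) (simplex_std 2)) (simplex_std n) :=
  SMap collapse_nat.

Lemma split_subproof i j : i <= j -> j <= n ->
  (if i < k then 0 else if i == k then 1 else 2)
    <= (if j < k then 0 else if j == k then 1 else 2).
Proof. by case: (ltngtP i k); case: (ltngtP j k); lia. Qed.

Definition split_at : Delta n 2 := dnat 2 split_subproof.

Lemma dv_split i : i <= n ->
  dv split_at i = if i < k then 0 else if i == k then 1 else 2.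
Proof. by move=> h; rewrite dv_dnat //; case: (i < k) => //; case: eqP. Qed.

Lemma collapse_split m (a : simplex_std n m) :
  collapse m (a, dcomp split_at a : simplex_std 2 m) = a.
Proof.
apply: dv_eq => i im; rewrite dv_collapse //= dv_comp dv_split ?dv_le //.
by rewrite /collapse_val; case: (ltngtP (dv a i) k) => h /=; lia.
Qed.

(** The retraction takes each vertex to itself or to [k], so a missed vertex other than [k] stays
    missed. Off the row [0] the values are at least [k > 0], and off the row [2] at most [k < n]. *)
Lemma collapse_horn m (x : sprod (simplex_std n) (simplex_std 2) m) : 0 < k < n ->
  horn_pred k x.1 \/ horn21_pred x.2 -> horn_pred k (collapse m x).
Proof.
case: x => a s kn /=; case=> [/horn_predE [i [il ik h]]|[h|h]]; apply/horn_predE.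
- exists i; split=> // j jm; rewrite dv_collapse //=; have := h j jm.
  by rewrite /collapse_val; case: (dv s j) => [|[|x]] /=; lia.
- exists 0; split=> [//||j jm]; first by lia.
  rewrite dv_collapse //= /collapse_val; have := h j jm.
  by case: (dv s j) => [|[|x]] //=; lia.
- exists n; split=> [//||j jm]; first by lia.
  rewrite dv_collapse //= /collapse_val; have := h j jm; have := dv_le s j.
  by case: (dv s j) => [|[|[|x]]] //=; lia.
Qed.
End Retract.

Lemma prod_horn_act (D : sset) n (k : 'I_n.+1) :
  @sub_closed (sprod D (simplex_std n)) (fun m x => horn_pred k x.2).
Proof. by move=> m l a x; apply: horn_act. Qed.

(** [D x Lambda^n_k -> D x Delta^n] is a retract of the corner product of itself
    with [Lambda^2_1 -> Delta^2], by Joyal's retraction [collapse]. *)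
Lemma prod_horn_rlp (E B D : sset) (p : smap E B) n (k : 'I_n.+1) :
  inner_fib p -> 0 < k < n -> rlp (subsset_incl (@prod_horn_act D n k)) p.
Proof.
move=> pI kn u v uv.
pose Y := sprod D (simplex_std n).
have rN m l (a : Delta m l) (y : sprod Y (simplex_std 2) l) :
    ((sact a y).1.1, collapse k m ((sact a y).1.2, (sact a y).2)) =
    sact a ((y.1.1, collapse k l (y.1.2, y.2)) : Y l) :> Y m.
  congr (_, _).
  exact: (snat (collapse k) a ((y.1.2, y.2) : sprod (simplex_std n) (simplex_std 2) l)).
pose r : smap (sprod Y (simplex_std 2)) Y :=
  @SMap (sprod Y (simplex_std 2)) Y
    (fun m y => (y.1.1, collapse k m (y.1.2, y.2))) rN.
pose cA := pcorner_act (@prod_horn_act D n k).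
have rC m (y : subsset cA m) : horn_pred k (r m (sval y)).2.
  by case: y => y h; apply: collapse_horn.
have r'N m l (a : Delta m l) (y : subsset cA l) :
    exist (fun x : Y m => horn_pred k x.2) (r m (sval (sact a y))) (rC m (sact a y)) =
    sact a (exist _ (r l (sval y)) (rC l y) : subsset (@prod_horn_act D n k) l).
  by apply: sval_eq; exact: (snat r a (sval y)).
pose r' : smap (subsset cA) (subsset (@prod_horn_act D n k)) :=
  @SMap (subsset cA) (subsset (@prod_horn_act D n k)) _ r'N.
have [|l [lu lv]] :=
    @pcorner_rlp _ _ (@prod_horn_act D n k) _ _ p pI (u \os r') (v \os r).
  apply: smap_eq => m y /=.
  exact: (congr1 (fun f : smap (subsset (@prod_horn_act D n k)) B => f m (r' m y)) uv).
have sN m j (a : Delta m j) (y : Y j) :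
    (sact a y, dcomp (split_at k) (sact a y).2 : simplex_std 2 m) =
    sact a ((y, dcomp (split_at k) y.2) : sprod Y (simplex_std 2) j).
  by congr (_, _); rewrite /= dcompA.
pose s : smap Y (sprod Y (simplex_std 2)) :=
  @SMap Y (sprod Y (simplex_std 2)) (fun m y => (y, dcomp (split_at k) y.2)) sN.
have rs m y : r m (s m y) = y.
  by case: y => d a; rewrite /= -[LHS]/(d, collapse k m (a, _)) collapse_split.
exists (l \os s); split; apply: smap_eq => m y.
  have hy : pcorner_pred (fun m (x : Y m) => horn_pred k x.2) (s m (sval y)).
    by left; exact: (svalP y).
  have := congr1 (fun f : smap (subsset cA) E => f m (exist _ _ hy)) lu.
  move=> /= ->; congr (u m _); apply: sval_eq; exact: rs.
have := congr1 (fun f : smap (sprod Y (simplex_std 2)) B => f m (s m y)) lv.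
by move=> /= ->; rewrite -[in RHS](rs m y).
Qed.

Lemma dcomp1l m n (a : Delta m n) : dcomp (did n) a = a.
Proof. by apply: delta_eq => i; rewrite !mk_deltaE. Qed.

Lemma dcomp1r m n (a : Delta m n) : dcomp a (did m) = a.
Proof. by apply: delta_eq => i; rewrite !mk_deltaE. Qed.

(** Transpose the lifting problem to [D x Lambda^n_k -> D x Delta^n]; a map into [map_space] is
    transposed by evaluation at the identity simplex [did]. *)
Lemma map_space_inner_fib (D E B : sset) (p : smap E B)
  (P : smap (map_space D E) (map_space D B)) :
  (forall n f k x, sfun (P n f) k x = p k (sfun f k x)) ->
  inner_fib p -> inner_fib P.
Proof.
move=> PE pI n k kn u v uv.
have evalN (X : sset) m j (b : Delta m j) (f : map_space D X j) (x : D j) :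
    sfun (sact b f) m (sact b x, did m) = sact b (sfun f j (x, did j)).
  by rewrite -snat /= dcomp1r dcomp1l.
have uN m j (b : Delta m j) (y : subsset (@prod_horn_act D n k) j) :
    sfun (u m (exist _ (sval (sact b y)).2 (svalP (sact b y)))) m
      ((sval (sact b y)).1, did m) =
    sact b (sfun (u j (exist _ (sval y).2 (svalP y))) j ((sval y).1, did j)).
  rewrite -evalN -snat; congr (sfun (u m _) m _); exact: sval_eq.
pose u' : smap (subsset (@prod_horn_act D n k)) E :=
  @SMap (subsset (@prod_horn_act D n k)) E _ uN.
have vN m j (b : Delta m j) (y : sprod D (simplex_std n) j) :
    sfun (v m (sact b y).2) m ((sact b y).1, did m) =
    sact b (sfun (v j y.2) j (y.1, did j)).
  by rewrite -evalN -snat.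
pose v' : smap (sprod D (simplex_std n)) B := @SMap (sprod D (simplex_std n)) B _ vN.
have [|l [lu lv]] := @prod_horn_rlp E B D p n k pI kn u' v'.
  apply: smap_eq => m [[x a] h] /=; rewrite -PE; congr (sfun _ m _).
  move: (svalP _) => h1.
  have e := congr1 (fun f : smap (horn k) (map_space D B) =>
    f m (exist (fun a : simplex_std n m => horn_pred k a) a h1)) uv.
  exact: e.
exists (simplex_map (l : map_space D E n)); split;
  apply: smap_eq => m y; apply: smap_eq => j [x a].
  case: y => y h /=.
  have h' : horn_pred k (dcomp y a : simplex_std n j) by exact: (horn_act a h).
  have := congr1 (fun f : smap (subsset (@prod_horn_act D n k)) E =>
    f j (exist (fun x : sprod D (simplex_std n) j => horn_pred k x.2)
           (x, dcomp y a) h')) lu.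
  move=> /= ->.
  rewrite (_ : exist _ _ _ = sact a (exist _ y h : horn k m)); last exact: sval_eq.
  by rewrite snat /= dcomp1r.
rewrite /= PE /=.
have := congr1 (fun f : smap (sprod D (simplex_std n)) B => f j (x, dcomp y a)) lv.
move=> /= ->.
by rewrite -[dcomp y a]/(sact a (y : simplex_std n m)) snat /= dcomp1r.
Qed.

(** * Quasi-categories as inner fibrations over the point, and fibres *)

Definition to_point (X : sset) : smap X (simplex_std 0).
Proof.
refine (@SMap X (simplex_std 0) (fun n _ => dto0 n) _).
by move=> m n a x; apply: delta_eq => i; rewrite !mk_deltaE.
Defined.

Lemma to_point_unique (X : sset) (f g : smap X (simplex_std 0)) : f = g.
Proof.
by apply: smap_eq => n x; apply: delta_eq => i; rewrite [LHS]ord1 [RHS]ord1.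
Qed.

Lemma qcat_inner_fib (X : sset) : is_qcat X <-> inner_fib (to_point X).
Proof.
split=> h n k kn u; last first.
  have [|l [lu _]] := h n k kn u (to_point _); last by exists l.
  exact: to_point_unique.
by move=> v _; have [l lu] := h n k kn u; exists l; split => //; exact: to_point_unique.
Qed.

Lemma map_space_qcat (D X : sset) : is_qcat X -> is_qcat (map_space D X).
Proof.
move=> /qcat_inner_fib h; apply/qcat_inner_fib => n k kn u v _.
have PN m j (a : Delta m j) (f : map_space D X j) :
  (to_point X \os sact a f : map_space D (simplex_std 0) m) =
    sact a (to_point X \os f : map_space D (simplex_std 0) j).
  by apply: smap_eq.
pose P : smap (map_space D X) (map_space D (simplex_std 0)) :=
  @SMap (map_space D X) (map_space D (simplex_std 0)) _ PN.
have [//||l [lu _]] := @map_space_inner_fib D _ _ (to_point X) P _ h n k kn u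
    (simplex_map (to_point _ : map_space D (simplex_std 0) n)).
  apply: smap_eq => m x; apply: smap_eq => j y; apply: delta_eq => i.
  by rewrite [LHS]ord1 [RHS]ord1.
by exists l; split => //; exact: to_point_unique.
Qed.

(** Lift the horn over the totally degenerate simplex at [y]; the filler then stays in the fibre. *)
Lemma sfibre_qcat (X Y : sset) (f : smap X Y) (y : Y 0) :
  inner_fib f -> is_qcat (sfibre f y).
Proof.
move=> fI n k kn u.
have [|l [lu lv]] := fI n k kn (sfibre_incl f y \os u) (simplex_map (cst n y)).
  by apply: smap_eq => m x /=; rewrite sact_cst; exact: (svalP (u m x)).
have lf m (a : simplex_std n m) : f m (l m a) = cst m y.
  have := congr1 (fun g : smap (simplex_std n) Y => g m a) lv.
  by move=> /= ->; rewrite sact_cst.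
have lN m j (a : Delta m j) (x : simplex_std n j) :
    exist (fun z => f m z = cst m y) (l m (sact a x)) (lf m (sact a x)) =
    sact a (exist _ (l j x) (lf j x) : sfibre f y j).
  by apply: sval_eq; exact: snat.
exists (@SMap (simplex_std n) (sfibre f y) _ lN).
apply: smap_eq => m x; apply: sval_eq => /=.
exact: (congr1 (fun g : smap (horn k) X => g m x) lu).
Qed.

(** * Filling horns by faces *)

Lemma face_face (X : sset) n i j (x : X n.+2) : i < j <= n.+2 ->
  sact (dface n i) (sact (dface n.+1 j) x) =
  sact (dface n j.-1) (sact (dface n.+1 i) x).
Proof.
move=> ij; rewrite -!sactM; congr sact; apply: dv_eq => t tn.
by rewrite !dv_comp !dv_face; rewrite ?/bump; lia.
Qed.

Section HornMap.
Context (X : sset) (n : nat) (k : 'I_n.+3) (y : nat -> X n.+1).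
Hypothesis yP : forall i j, i < j <= n.+2 -> i <> k -> j <> k ->
  sact (dface n j.-1) (y i) = sact (dface n i) (y j).

Let pull m (a : Delta m n.+2) i : Delta m n.+1 :=
  dcomp (ddeg n.+1 (minn i n.+1)) a.

Let dv_pull m (a : Delta m n.+2) i t : i <= n.+2 ->
  (forall j, j <= m -> dv a j <> i) -> t <= m ->
  bump i (dv (pull a i) t) = dv a t.
Proof.
move=> ii h tm; rewrite dv_comp dv_deg ?dv_le //; last by lia.
by have := dv_le a t; have := h t tm; rewrite /bump /unbump; lia.
Qed.

(** A simplex missing both [i] and [j] factors through the common face of the two faces, where [yP]
    identifies the given simplices. *)
Let pull_indep m (a : Delta m n.+2) i j : i <= n.+2 -> j <= n.+2 ->
  i <> k -> j <> k ->
  (forall t, t <= m -> dv a t <> i) -> (forall t, t <= m -> dv a t <> j) ->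
  sact (pull a i) (y i) = sact (pull a j) (y j).
Proof.
wlog ij : i j / i <= j => [IH|].
  by move=> *; case: (leqP i j) => h; [|symmetry]; apply: IH => //; lia.
move: ij; rewrite leq_eqVlt => /orP [/eqP -> //|ij] ii jj ik jk hi hj.
have [||c ec] := @delta_miss m n (pull a i) j.-1; first lia.
  move=> t tm; have := dv_pull ii hi tm; have := hj t tm; rewrite /bump; lia.
rewrite -ec sactM yP //; last by lia.
rewrite -sactM; congr sact; apply: dv_eq => t tm.
have := dv_pull ii hi tm; have := dv_pull jj hj tm.
rewrite -ec !dv_comp !dv_face ?dv_le // /bump; lia.
Qed.

Let miss m (a : horn k m) : exists i, [/\ i <= n.+2, i <> k &
  forall t, t <= m -> dv (sval a : Delta m n.+2) t <> i].
Proof. exact/horn_predE/(svalP a). Qed.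

Let hmap m (a : horn k m) : X m :=
  let i := sval (cid (miss a)) in sact (pull (sval a) i) (y i).

Let hmapE m (a : horn k m) i : i <= n.+2 -> i <> k ->
  (forall t, t <= m -> dv (sval a : Delta m n.+2) t <> i) ->
  hmap a = sact (pull (sval a) i) (y i).
Proof. by move=> *; rewrite /hmap; case: cid => j [*]; exact: pull_indep. Qed.

Lemma horn_map_exists : exists u : smap (horn k) X,
  forall m (a : horn k m) i, i <= n.+2 -> i <> k ->
    forall c : Delta m n.+1, dcomp (dface n.+1 i) c = sval a ->
    u m a = sact c (y i).
Proof.
have hN m l (c : Delta m l) (a : horn k l) : hmap (sact c a) = sact c (hmap a).
  have [i [ii ik h]] := miss a; rewrite (hmapE ii ik h) (@hmapE _ _ i) //.
    by rewrite -sactM /pull dcompA.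
  by move=> t tm; rewrite /= dv_comp; apply: h; exact: dv_le.
exists (SMap hN) => m a i ii ik c ec /=.
have h t : t <= m -> dv (sval a : Delta m n.+2) t <> i.
  by move=> tm; rewrite -ec dv_comp dv_face ?dv_le // /bump; lia.
rewrite (hmapE ii ik h); congr sact; apply: dv_eq => t tm.
have := dv_pull ii h tm; rewrite -{2}ec [in RHS]dv_comp dv_face ?dv_le //.
by rewrite /bump; lia.
Qed.
End HornMap.

(** The faces are a function on [nat], whose values at [k] and beyond [n.+2] are arbitrary. *)
Lemma horn_lift (E B : sset) (p : smap E B) n k (y : nat -> E n.+1) (b : B n.+2) :
  inner_fib p -> 0 < k < n.+2 ->
  (forall i j, i < j <= n.+2 -> i <> k -> j <> k ->
    sact (dface n j.-1) (y i) = sact (dface n i) (y j)) ->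
  (forall i, i <= n.+2 -> i <> k -> sact (dface n.+1 i) b = p n.+1 (y i)) ->
  exists2 e : E n.+2, p n.+2 e = b &
    forall i, i <= n.+2 -> i <> k -> sact (dface n.+1 i) e = y i.
Proof.
move=> pI kn yP bP.
have kE : (inord k : 'I_n.+3) = k :> nat by rewrite inordK //; lia.
have [|u uE] := @horn_map_exists E n (inord k) y; first by rewrite kE.
rewrite kE in uE.
have [||l [lu lv]] := pI n.+2 (inord k) _ u (simplex_map b); first by rewrite kE.
  apply: smap_eq => m a /=.
  have /horn_predE [i [ii ik h]] := svalP a; rewrite kE in ik.
  have [|c ec] := delta_miss ii (a := sval a : Delta m n.+2).
    by move=> j jm; apply/eqP/h.
  by rewrite (uE _ _ i ii ik c ec) snat -bP // -sactM ec.
exists (l n.+2 (did n.+2)).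
  have := congr1 (fun f : smap (simplex_std n.+2) B => f _ (did n.+2)) lv.
  by move=> /= ->; rewrite sact1.
move=> i ii ik; rewrite -snat /= dcomp1l.
have h : horn_pred (inord k : 'I_n.+3) (dface n.+1 i : simplex_std n.+2 n.+1).
  apply/horn_predE; exists i; split => //; first by rewrite kE.
  by move=> j jn; rewrite dv_face // /bump; lia.
have := congr1 (fun f : smap (horn (inord k : 'I_n.+3)) E => f _ (exist _ _ h)) lu.
move=> /= ->; rewrite (uE _ _ i ii ik (did n.+1)) ?sact1 //=; exact: dcomp1r.
Qed.

Lemma horn_fill (X : sset) n k (y : nat -> X n.+1) : is_qcat X -> 0 < k < n.+2 ->
  (forall i j, i < j <= n.+2 -> i <> k -> j <> k ->
    sact (dface n j.-1) (y i) = sact (dface n i) (y j)) ->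
  exists e : X n.+2, forall i, i <= n.+2 -> i <> k -> sact (dface n.+1 i) e = y i.
Proof.
move=> /qcat_inner_fib h kn yP.
have [|e _ eP] := @horn_lift _ (simplex_std 0) _ n k y
  (dto0 n.+2 : simplex_std 0 n.+2) h kn yP; last by exists e.
by move=> i ii ik; apply: delta_eq => j; rewrite !mk_deltaE.
Qed.

(** * The homotopy category of a quasi-category *)

Lemma dv_edge n (i j : 'I_n.+1) (ij : i <= j) t : t <= 1 ->
  dv (dedge ij) t = if t == 0 then i else j.
Proof. by move=> h; rewrite /dv mk_deltaE -val_eqE /= inordK //; case: eqP. Qed.

Lemma d01E : d01 = dface 1 2.
Proof. by apply: dv_eq => -[|[|//]] h; rewrite dv_face // dv_edge. Qed.

Lemma d12E : d12 = dface 1 0.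
Proof. by apply: dv_eq => -[|[|//]] h; rewrite dv_face // dv_edge. Qed.

Lemma d02E : d02 = dface 1 1.
Proof. by apply: dv_eq => -[|[|//]] h; rewrite dv_face // dv_edge. Qed.

Lemma dvtx0E : dvtx (ord0 : 'I_2) = dface 0 1.
Proof. by apply: dv_eq => -[|//] h; rewrite dv_face // /dv mk_deltaE. Qed.

Lemma dvtx1E : dvtx (ord_max : 'I_2) = dface 0 0.
Proof. by apply: dv_eq => -[|//] h; rewrite dv_face // /dv mk_deltaE. Qed.

(** The edges come in the order [01], [12], [02]. *)
Definition triangle (X : sset) (t : X 2) (a b c : X 1) : Prop :=
  [/\ sact (dface 1 2) t = a, sact (dface 1 0) t = b & sact (dface 1 1) t = c].

Definition composite (X : sset) (a b c : X 1) : Prop :=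
  exists t : X 2, triangle t a b c.

Lemma triangle_lift (E B : sset) (p : smap E B) (t : B 2) (x y z : E 0)
  (a : edge x y) (b : edge y z) c : inner_fib p ->
  triangle t (p 1 (sval a)) (p 1 (sval b)) c ->
  exists2 s : E 2, p 2 s = t & triangle s (sval a) (sval b) (sact (dface 1 1) s).
Proof.
move=> pI [ta tb _].
case: a b ta tb => [a [ax ay]] [b [bx bz]] /= ta tb.
have [//|i j /andP[ij jn]|i|s st sP] := @horn_lift _ _ p 0 1
  (fun i => if i == 0 then b else a) t pI.
- case: i j ij jn => [|[|i]] [|[|[|j]]] //= _ _ _ _.
  by rewrite -dvtx0E -dvtx1E -/(vertex _ _) -/(vertex _ _) ay bx.
- by case: i => [|[|[|i]]].
by exists s => //; split=> //; [rewrite (sP 2)|rewrite (sP 0)].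
Qed.

(** The names list the vertices: the horn [Lambda^3_2] lacks the face [t013] opposite to the vertex
    [2]. *)
Lemma tetra_lift2 (E B : sset) (p : smap E B) (w : B 3) (t012 t023 t123 : E 2)
  (a b c d e f : E 1) : inner_fib p ->
  triangle t012 a b c -> triangle t123 b d e -> triangle t023 c d f ->
  sact (dface 2 3) w = p 2 t012 -> sact (dface 2 0) w = p 2 t123 ->
  sact (dface 2 1) w = p 2 t023 ->
  exists2 t013 : E 2, p 2 t013 = sact (dface 2 2) w & triangle t013 a e f.
Proof.
move=> pI [a1 a2 a3] [b1 b2 b3] [c1 c2 c3] w3 w0 w1.
have [//|i j /andP[ij jn]|i|s st sP] := @horn_lift _ _ p 1 2
  (fun i => if i == 0 then t123 else if i == 1 then t023 else t012) w pI.
- by case: i j ij jn => [|[|[|i]]] [|[|[|[|j]]]] //= _ _ _ _; congruence.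
- by case: i => [|[|[|[|i]]]].
exists (sact (dface 2 2) s); first by rewrite snat st.
split.
- by rewrite -(@face_face _ _ 2 3) // sP.
- by rewrite (@face_face _ _ 0 2) // sP.
- by rewrite (@face_face _ _ 1 2) // sP.
Qed.

Section Composites.
Context (X : sset).
Implicit Types a b c d e f : X 1.

Lemma composite_1f (x y : X 0) (a : edge x y) : composite (cst 1 x) (sval a) (sval a).
Proof.
have [_ _ _ [h1 h2 h3]] := dsup_dinf a; exists (sact dinf (sval a)).
by split; rewrite -?d01E -?d12E -?d02E.
Qed.

Lemma composite_f1 (x y : X 0) (a : edge x y) : composite (sval a) (cst 1 y) (sval a).
Proof.
have [h1 h2 h3 _] := dsup_dinf a; exists (sact dsup (sval a)).
by split; rewrite -?d01E -?d12E -?d02E.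
Qed.

Lemma composite_harr (x y z : X 0) (a : edge x y) (b : edge y z) (c : edge x z) :
  composite (sval a) (sval b) (sval c) ->
  (harr b : @Hom (ho X) y z) \oc harr a = harr c.
Proof. by case=> t []; rewrite -d01E -d12E -d02E => *; apply: harr_tri; eauto. Qed.

Lemma composite_edge (x y z : X 0) (a : edge x y) (b : edge y z) c :
  composite (sval a) (sval b) c -> exists h : edge x z, sval h = c.
Proof.
case: a b => a [ax ay] [b [bx bz]] [t [/= ta tb tc]].
suff h : vertex ord0 c = x /\ vertex ord_max c = z.
  by exists (exist _ c h).
rewrite -ax -bz -ta -tb -tc /vertex.
by rewrite dvtx0E dvtx1E (@face_face _ _ 0 1) // (@face_face _ _ 1 2).
Qed.

Lemma composite_const (x : X 0) : composite (cst 1 x) (cst 1 x) (cst 1 x).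
Proof. by exists (cst 2 x); split; rewrite sact_cst. Qed.

Hypothesis Xq : is_qcat X.

(** The two inner fillings of a hollow tetrahedron, with edges
    [01, 12, 02, 23, 13, 03] labelled [a, b, c, d, e, f]. *)
Lemma composite_assoc1 a b c d e f :
  composite a b c -> composite b d e -> composite a e f -> composite c d f.
Proof.
move=> [t3 [a1 a2 a3]] [t0 [b1 b2 b3]] [t2 [c1 c2 c3]].
have [//|i j /andP[ij jn]|s sP] := @horn_fill X 1 1
  (fun i => if i == 0 then t0 else if i == 2 then t2 else t3) Xq.
  by case: i j ij jn => [|[|[|i]]] [|[|[|[|j]]]] //= _ _ _ _; congruence.
exists (sact (dface 2 1) s); split.
- by rewrite -(@face_face _ _ 1 3) // (sP 3).
- by rewrite (@face_face _ _ 0 1) // (sP 0).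
- by rewrite -(@face_face _ _ 1 2) // (sP 2).
Qed.

Lemma composite_assoc2 a b c d e f :
  composite a b c -> composite b d e -> composite c d f -> composite a e f.
Proof.
move=> [t3 [a1 a2 a3]] [t0 [b1 b2 b3]] [t1 [c1 c2 c3]].
have [//|i j /andP[ij jn]|s sP] := @horn_fill X 1 2
  (fun i => if i == 0 then t0 else if i == 1 then t1 else t3) Xq.
  by case: i j ij jn => [|[|[|i]]] [|[|[|[|j]]]] //= _ _ _ _; congruence.
exists (sact (dface 2 2) s); split.
- by rewrite -(@face_face _ _ 2 3) // (sP 3).
- by rewrite (@face_face _ _ 0 2) // (sP 0).
- by rewrite (@face_face _ _ 1 2) // (sP 1).
Qed.

Lemma composite_exists (x y z : X 0) (a : edge x y) (b : edge y z) :
  exists c : edge x z, composite (sval a) (sval b) (sval c).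
Proof.
have /qcat_inner_fib Xi := Xq.
have [|t _ tP] := @triangle_lift _ _ _ (dto0 2 : simplex_std 0 2) x y z a b
  (dto0 1) Xi.
  by split; apply: delta_eq => i; rewrite !mk_deltaE.
have ct : composite (sval a) (sval b) (sact (dface 1 1) t) by exists t.
by have [c ec] := composite_edge ct; exists c; rewrite ec.
Qed.

(** Homotopy of edges is [composite] with a constant second edge. Its properties here are
    tetrahedron fillings with some degenerate faces. *)
Lemma homotopic_sym (x y : X 0) (a b : edge x y) :
  composite (sval a) (cst 1 y) (sval b) -> composite (sval b) (cst 1 y) (sval a).
Proof.
move=> h; exact: composite_assoc1 h (composite_const y) (composite_f1 a).
Qed.

Lemma homotopic_trans (y : X 0) a b c :
  composite a (cst 1 y) b -> composite b (cst 1 y) c -> composite a (cst 1 y) c.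
Proof. move=> h h'; exact: composite_assoc2 h (composite_const y) h'. Qed.

Lemma composite_homotopicl (y z : X 0) a b c (f : edge y z) :
  composite a (cst 1 y) b -> composite a (sval f) c -> composite b (sval f) c.
Proof. move=> h h'; exact: composite_assoc1 h (composite_1f f) h'. Qed.

Lemma composite_unique (y z : X 0) a b c (f : edge y z) :
  composite a (sval f) b -> composite a (sval f) c -> composite b (cst 1 z) c.
Proof. move=> h h'; exact: composite_assoc1 h (composite_f1 f) h'. Qed.

(** A relation, since composites are unique only up to homotopy; the base case absorbs a
    homotopy. *)
Fixpoint chain_composite (x y : X 0) (p : chain x y) (e e' : X 1) : Prop :=
  match p with
  | cnil y => composite e (cst 1 y) e'
  | ccons _ _ _ f p' => exists2 e1, composite e (sval f) e1 & chain_composite p' e1 e'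
  end.

Lemma chain_composite_homotopic (w x y : X 0) (p : chain x y) (e e1 : edge w x) e' :
  composite (sval e) (cst 1 x) (sval e1) ->
  chain_composite p (sval e) e' -> chain_composite p (sval e1) e'.
Proof.
case: p e e1 => [{}x|{}x z {}y f p] e e1 h /=.
  exact: homotopic_trans (homotopic_sym h).
by move=> [e2 he hp]; exists e2 => //; exact: composite_homotopicl h he.
Qed.

Lemma chain_composite_app (w x y z : X 0) (p : chain x y) (q : chain y z)
  (e : edge w x) e' :
  chain_composite (capp p q) (sval e) e' <->
  exists2 e1 : edge w y, chain_composite p (sval e) (sval e1) &
    chain_composite q (sval e1) e'.
Proof.
elim: p q e => [{}x|{}x t {}y f p IH] q e /=.
  split=> [h|[e1 h]]; first by exists e => //; exact: composite_f1.
  by apply: chain_composite_homotopic (homotopic_sym h).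
split=> [[e1 h]|[e2 [e1 h hp] hq]].
  have [e1' ee] := composite_edge h; rewrite -ee in h *.
  by move=> /IH [e2 hp hq]; exists e2 => //; exists (sval e1').
have [e1' ee] := composite_edge h; rewrite -ee in h hp.
by exists (sval e1') => //; apply/IH; exists e2.
Qed.

(** The chains act on the homotopy classes of edges by composition, through the
    congruence [ceqv]: hence arrows of [ho X] are equal only if homotopic. *)
Lemma chain_composite_eqv (w x y : X 0) (p q : chain x y) (e : edge w x) e' :
  ceqv p q -> chain_composite p (sval e) e' <-> chain_composite q (sval e) e'.
Proof.
move=> pq; elim: pq w e e' => {x y p q} [||x y p q r _ IH _ IH'|
  x y z p p' q q' _ IH _ IH'|x e0 e0E|x y z f g h t tf tg th] //.
- by move=> x y p q _ IH w e e'; rewrite IH.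
- by move=> w e e'; rewrite IH IH'.
- move=> w e e'; rewrite !chain_composite_app.
  by split=> -[e1 h1 h2]; exists e1; [apply/IH|apply/IH'|apply/IH|apply/IH'].
- move=> w e e' /=; rewrite e0E; split=> [[e1]|h]; first exact: homotopic_trans.
  by exists (sval e); first exact: composite_f1.
- have fgh : composite (sval f) (sval g) (sval h).
    by exists t; rewrite /triangle -d01E -d12E -d02E.
  move=> w e e' /=; split.
    move=> [e1 h1 [e2 h2 h3]]; exists e2 => //; exact: composite_assoc2 h1 fgh h2.
  move=> [e2 h2 h3]; have [e1 h1] := composite_exists e f.
  exists (sval e1) => //; exists e2 => //; exact: composite_assoc1 h1 fgh h2.
Qed.

Lemma cls_eqv (x y : X 0) (p q : chain x y) :
  cls (@ceqv X x y) p = cls (@ceqv X x y) q -> ceqv p q.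
Proof. by move=> /(congr1 sval) /= ->; exact: ceqv_refl. Qed.

Lemma const_edge_subproof (x : X 0) :
  vertex ord0 (cst 1 x) = x /\ vertex ord_max (cst 1 x) = x.
Proof. by rewrite /vertex !sact_cst. Qed.

Definition const_edge (x : X 0) : edge x x := exist _ (cst 1 x) (const_edge_subproof x).

Lemma harr_const (x : X 0) : harr (const_edge x) = @idc (ho X) x.
Proof. exact/cls_ceqv/ceqv_deg. Qed.

(** Let the two one-edge chains act on the constant edge at [x]. *)
Lemma harr_eq (x y : X 0) (a b : edge x y) :
  harr a = harr b -> composite (sval a) (cst 1 y) (sval b).
Proof.
move=> /cls_eqv /(chain_composite_eqv (const_edge x) (sval b)) [_ [|e1 /= h1 h2]].
  by exists (sval b); [exact: composite_1f|exact: composite_f1].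
exact: homotopic_trans (composite_unique (composite_1f a) h1) h2.
Qed.

Lemma harr_surj (x y : ho X) (a : Hom x y) : exists e : edge x y, a = harr e.
Proof.
elim/ho_ind: a => {x y} [x|x y z f a [e ->]].
  by exists (const_edge x); rewrite harr_const.
by have [c h] := composite_exists f e; exists c; exact: composite_harr.
Qed.
End Composites.

(** * Homotopy categories of fibres *)

Lemma sphere_act (X : sset) (b : X 0) (t : X 2) m (a : Delta m 2) :
  triangle t (cst 1 b) (cst 1 b) (cst 1 b) -> boundary_pred (a : simplex_std 2 m) ->
  sact a t = cst m b.
Proof.
move=> [t2 t0 t1] [i ii h]; have [c <-] := delta_miss ii h; rewrite sactM.
by case: i ii {h} => [|[|[|]]] // _; rewrite ?t0 ?t1 ?t2 sact_cst.
Qed.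

(** Fill the horn [Lambda^4_2] with the degenerate faces
    [s1 t, s2 t, -, s0 t, s1 t]. *)
Lemma sphere_tetra (X : sset) (b : X 0) (t : X 2) : is_qcat X ->
  triangle t (cst 1 b) (cst 1 b) (cst 1 b) ->
  exists w : X 3, [/\ sact (dface 2 0) w = t, sact (dface 2 1) w = cst 2 b,
    sact (dface 2 2) w = cst 2 b & sact (dface 2 3) w = t].
Proof.
move=> Xq tP.
have one i j : i <= 2 -> j = i \/ j = i.+1 ->
    sact (dface 2 j) (sact (ddeg 2 i) t) = t.
  move=> ii ij; rewrite -sactM -[RHS]sact1; congr sact; apply: dv_eq => l l2.
  rewrite dv_comp dv_face // dv_id // dv_deg //; last by rewrite /bump; lia.
  by rewrite /bump /unbump; lia.
have cons i j l : i <= 2 -> j <= 3 -> l <= 2 ->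
    (forall h, h <= 2 -> unbump i (bump j h) != l) ->
    sact (dface 2 j) (sact (ddeg 2 i) t) = cst 2 b.
  move=> ii jj ll h; rewrite -sactM; apply: sphere_act tP _; exists l => // k k2.
  rewrite dv_comp dv_face // dv_deg ?h //; by rewrite /bump; lia.
have c0 i j : i <= 2 -> j <= 3 -> j < i \/ i.+1 < j ->
    sact (dface 2 j) (sact (ddeg 2 i) t) = cst 2 b.
  move=> ii jj [h|h].
    by apply: (cons i j j) => // [|k k2]; rewrite /bump /unbump; lia.
  by apply: (cons i j j.-1) => // [|k k2]; rewrite /bump /unbump; lia.
have [//|i j /andP[ij jn]|s sP] := @horn_fill X 2 2 (fun i =>
  sact (ddeg 2 (if i == 1 then 2 else if i == 3 then 0 else 1)) t) Xq.
  case: i j ij jn => [|[|[|[|i]]]] [|[|[|[|[|j]]]]] //= _ _ _ _;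
    by [rewrite !one //; lia|rewrite !c0 //; lia].
exists (sact (dface 3 2) s); split.
- by rewrite (@face_face _ _ 0 2) // (sP 0) //= one //; lia.
- by rewrite (@face_face _ _ 1 2) // (sP 1) //= c0 //; lia.
- by rewrite -(@face_face _ _ 2 3) // (sP 3) //= c0 //; lia.
- by rewrite -(@face_face _ _ 2 4) // (sP 4) //= one //; lia.
Qed.

Lemma harr_hom_eq (X : sset) (u v u' v' : X 0) (f : edge u v) (g : edge u' v') :
  is_qcat X -> @hom_eq (ho X) u v (harr f) u' v' (harr g) ->
  composite (sval f) (cst 1 v') (sval g).
Proof.
move=> Xq /hom_eqP [eu [ev]]; case: u' / eu g => g; case: v' / ev g => g /= /esym.
exact: harr_eq.
Qed.

Section Fibre.
Context (E B : sset) (p : smap E B) (b : B 0).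
Hypotheses (Eq : is_qcat E) (Bq : is_qcat B) (pI : inner_fib p).
Let F := sfibre p b.

Lemma fibre_triangle (t : E 2) (a c d : F 1) : p 2 t = cst 2 b ->
  triangle t (sval a) (sval c) (sval d) -> composite a c d.
Proof.
move=> pt [h1 h2 h3]; exists (exist _ t pt : F 2).
by split; apply: sval_eq.
Qed.

Lemma fibre_edge (x y : F 0) (e : edge (sval x) (sval y)) :
  p 1 (sval e) = cst 1 b -> exists e' : edge x y, sval (sval e') = sval e.
Proof.
case: e => e [ex ey] /= pe; unshelve eexists (exist _ (exist _ e pe : F 1) _) => //.
by split; apply: sval_eq.
Qed.

(** Lift the triangle along [e] and a constant edge: the third edge is homotopic to [e] and lies
    over the constant edge at [b]. *)
Lemma fibre_full (x y : F 0) (e : edge (sval x) (sval y)) :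
  composite (p 1 (sval e)) (cst 1 b) (cst 1 b) ->
  exists e' : edge x y, composite (sval e) (cst 1 (sval y)) (sval (sval e')).
Proof.
move=> [t tP].
have [|s ps [s1 s2 s3]] :=
    @triangle_lift _ _ p t _ _ _ e (const_edge (sval y)) (cst 1 b) pI.
  by rewrite /= smap_cst (svalP y).
have sc : composite (sval e) (cst 1 (sval y)) (sact (dface 1 1) s) by exists s.
have [f fE] := composite_edge (b := const_edge (sval y)) sc.
have [|e' e'E] := @fibre_edge x y f.
  by rewrite fE snat ps; case: tP.
by exists e'; rewrite e'E fE.
Qed.

(** The homotopy [s : h ~ 1] in [E] lies over a sphere [t] of [B]. Lifting [t]
    along two constant edges gives [k], and lifting the 3-simplex with opposite
    faces [t, t] and two constant faces, with [s] and the lift of [t] above the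
    first two, gives the missing face, a witness of [k h = 1] over [b]. *)
Lemma fibre_linv (x : F 0) (h : edge x x) :
  composite (sval (sval h)) (cst 1 (sval x)) (cst 1 (sval x)) ->
  exists2 k : edge x x, composite (sval h) (sval k) (cst 1 x) &
    composite (sval (sval k)) (cst 1 (sval x)) (cst 1 (sval x)).
Proof.
move=> [s sP]; set x0 := sval x in sP *; set c := const_edge x0.
have px : p 0 x0 = b by exact: svalP x.
have pc n : p n (cst n x0) = cst n b by rewrite smap_cst px.
have tP : triangle (p 2 s) (cst 1 b) (cst 1 b) (cst 1 b).
  case: sP => s1 s2 s3; split; rewrite -snat (s1, s2, s3) ?pc //.
  exact: (svalP (sval h)).
have [w [w0 w1 w2 w3]] := sphere_tetra Bq tP.
have [|t pt tT] := @triangle_lift _ _ p (p 2 s) _ _ _ c c (cst 1 b) pI.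
  by rewrite /= !pc.
have tc : composite (sval c) (sval c) (sact (dface 1 1) t) by exists t.
have [k0 k0E] := composite_edge tc.
have [|k kE] := @fibre_edge x x k0.
  by rewrite k0E snat pt; case: tP.
rewrite -k0E -kE in tT tc; exists k; last first.
  rewrite kE; apply: (@homotopic_sym _ Eq _ _ c); by rewrite -kE.
have cc : triangle (cst 2 x0) (cst 1 x0) (cst 1 x0) (cst 1 x0).
  by split; rewrite sact_cst.
have [|||u pu uT] := @tetra_lift2 _ _ p w s (cst 2 x0) t _ _ _ _ _ _ pI sP tT cc.
- by rewrite w3.
- by rewrite w0 pt.
- by rewrite w1 pc.
apply: (@fibre_triangle u); first by rewrite pu w2.
have -> : sval (cst 1 x) = cst 1 x0 by exact: sval_cst_fibre.
exact: uT.
Qed.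

Lemma ho_fibre_full (x y : ho F) (a : @Hom (ho E) (sval x) (sval y)) :
  hom_eq (farr (ho_map p) a) (@idc (ho B) b) ->
  exists a' : Hom x y, farr (ho_map (sfibre_incl p b)) a' = a.
Proof.
have [e ->] := harr_surj Eq a; rewrite ho_map_harr => he.
have [|e' h] := @fibre_full x y e.
  by move: he; rewrite -harr_const; exact: harr_hom_eq.
exists (harr e'); rewrite ho_map_harr.
have := @composite_harr _ _ _ _ e (const_edge (sval y))
  (edge_map (sfibre_incl p b) e') h.
by rewrite harr_const cmp1f.
Qed.

Lemma ho_fibre_linv (x : ho F) (a : Hom x x) :
  farr (ho_map (sfibre_incl p b)) a = idc _ ->
  exists2 a' : Hom x x, a' \oc a = idc x &
    farr (ho_map (sfibre_incl p b)) a' = idc _.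
Proof.
have Fq : is_qcat F by exact: sfibre_qcat.
have [e ->] := harr_surj Fq a; rewrite ho_map_harr -harr_const => /(harr_eq Eq) he.
have [|k hk ke] := @fibre_linv x e.
  exact: he.
exists (harr k); last first.
  have := @composite_harr _ _ _ _ (edge_map (sfibre_incl p b) k)
    (const_edge (sval x)) (const_edge (sval x)) ke.
  by rewrite ho_map_harr !harr_const cmp1f.
by rewrite (composite_harr (c := const_edge x)) // harr_const.
Qed.

(** The left inverse also becomes an identity in [ho E], so it has a left inverse of its own, which
    must be [a]. *)
Lemma ho_fibre_inv (x : ho F) (a : Hom x x) :
  farr (ho_map (sfibre_incl p b)) a = idc _ ->
  exists2 a' : Hom x x, a' \oc a = idc x & a \oc a' = idc x.
Proof.
move=> /ho_fibre_linv [a' a'a /ho_fibre_linv [a'' a''a' _]].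
exists a' => //; suff <- : a'' = a by [].
by rewrite -[LHS]cmpf1 -a'a cmpA a''a' cmp1f.
Qed.
End Fibre.

(** * Lifting adjunctions *)

(** Arrows packed with their endpoints: a strict 2-category becomes strictly
    associative and unital up to Leibniz equality of packed 2-cells. *)
Record cell (C : category) := Cell { cdom : C; ccod : C; carr : Hom cdom ccod }.
Arguments Cell {C cdom ccod} carr.

Lemma cellP (C : category) (x y x' y' : C) (f : Hom x y) (f' : Hom x' y') :
  Cell f = Cell f' <-> hom_eq f f'.
Proof.
split=> [e|[] //]; suff : hom_eq (carr (Cell f)) (carr (Cell f')) by [].
by rewrite e.
Qed.

Definition idcell (C : category) (x : C) : cell C := Cell (idc x).

(** Vertical composition, with a junk value when [f] and [g] are not
    composable. *)
Definition vcmp (C : category) (g f : cell C) : cell C :=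
  match pselect (ccod f = cdom g) with
  | left e => Cell (carr g \oc eq_arr e \oc carr f)
  | right _ => f
  end.

Notation "g • f" := (vcmp g f) (at level 50, left associativity).

Section Vertical.
Variable C : category.
Implicit Types f g h : cell C.

Lemma vcmpE (x y z : C) (g : Hom y z) (f : Hom x y) :
  Cell g • Cell f = Cell (g \oc f).
Proof.
rewrite /vcmp; case: pselect => //= e; rewrite (Prop_irrelevance e erefl).
by rewrite /eq_arr /= cmpf1.
Qed.

Lemma vcmp_eq_arr (x y y' z : C) (g : Hom y' z) (e : y = y') (f : Hom x y) :
  Cell (g \oc eq_arr e \oc f) = Cell g • Cell f.
Proof. by case: y' / e g => g; rewrite vcmpE /eq_arr /= cmpf1. Qed.

Lemma vcmp_dom g f : ccod f = cdom g -> cdom (g • f) = cdom f.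
Proof. by case: g f => [y z g] [x y' f] /= e; case: y / e g => g; rewrite vcmpE. Qed.

Lemma vcmp_cod g f : ccod f = cdom g -> ccod (g • f) = ccod g.
Proof. by case: g f => [y z g] [x y' f] /= e; case: y / e g => g; rewrite vcmpE. Qed.

Lemma vcmpA h g f : ccod f = cdom g -> ccod g = cdom h -> h • (g • f) = h • g • f.
Proof.
case: h g f => [z t h] [y z' g] [x y' f] /= e e'.
by case: y / e g => g; case: z / e' h => h; rewrite !vcmpE cmpA.
Qed.

Lemma vcmp1f x f : ccod f = x -> idcell x • f = f.
Proof. by case: f => [y z f] /= <-; rewrite vcmpE cmp1f. Qed.

Lemma vcmpf1 x f : cdom f = x -> f • idcell x = f.
Proof. by case: f => [y z f] /= <-; rewrite vcmpE cmpf1. Qed.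

Lemma cell_hom x y f : cdom f = x -> ccod f = y -> exists u : Hom x y, Cell u = f.
Proof. by case: f => [x' y' f] /= <- <-; exists f. Qed.
End Vertical.

Definition hcmp (K : two_cat) (a b c : K) (G : cell (thom b c))
    (F : cell (thom a b)) : cell (thom a c) :=
  Cell (carr G \o2 carr F).

Notation "G ∗ F" := (hcmp G F) (at level 40, left associativity).

Section Horizontal.
Variable K : two_cat.
Implicit Types a b c d : K.

Lemma hcmpA a b c d (H : cell (thom c d)) (G : cell (thom b c))
  (F : cell (thom a b)) : H ∗ (G ∗ F) = H ∗ G ∗ F.
Proof. by apply/cellP; exact: tcompA2. Qed.

Lemma hcmp1f a b (F : cell (thom a b)) : idcell (tid b) ∗ F = F.
Proof. by case: F => x y F; apply/cellP; exact: tcomp1f2. Qed.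

Lemma hcmpf1 a b (F : cell (thom a b)) : F ∗ idcell (tid a) = F.
Proof. by case: F => x y F; apply/cellP; exact: tcompf12. Qed.

Lemma hcmp_id a b c (g : thom b c) (f : thom a b) :
  idcell g ∗ idcell f = idcell (g \o1 f).
Proof. by rewrite /hcmp /= /comp2 app2_id. Qed.

Lemma interchange a b c (G' G : cell (thom b c)) (F' F : cell (thom a b)) :
  ccod G = cdom G' -> ccod F = cdom F' ->
  (G' • G) ∗ (F' • F) = (G' ∗ F') • (G ∗ F).
Proof.
case: G' G F' F => [y z G'] [x y1 G] [t s F'] [r t1 F] /= e e'.
case: y / e G' => G'; case: t / e' F' => F'.
by rewrite !vcmpE /hcmp /= /comp2 app2M.
Qed.

Lemma hcmp_lr a b c (G : cell (thom b c)) (F : cell (thom a b)) :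
  G ∗ F = (G ∗ idcell (ccod F)) • (idcell (cdom G) ∗ F).
Proof. by rewrite -interchange ?vcmpf1 ?vcmp1f. Qed.

Lemma hcmp_rl a b c (G : cell (thom b c)) (F : cell (thom a b)) :
  G ∗ F = (idcell (ccod G) ∗ F) • (G ∗ idcell (cdom F)).
Proof. by rewrite -interchange ?vcmpf1 ?vcmp1f. Qed.

Lemma whisker_r a b c (G' G : cell (thom b c)) (f : thom a b) :
  ccod G = cdom G' -> (G' • G) ∗ idcell f = (G' ∗ idcell f) • (G ∗ idcell f).
Proof. by move=> e; rewrite -interchange // vcmpf1. Qed.

Lemma whisker_l a b c (g : thom b c) (F' F : cell (thom a b)) :
  ccod F = cdom F' -> idcell g ∗ (F' • F) = (idcell g ∗ F') • (idcell g ∗ F).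
Proof. by move=> e; rewrite -interchange // vcmpf1. Qed.
End Horizontal.

Section Triangles.
Context (K : two_cat) (a b : K) (f : thom a b) (u : thom b a).
Context (e : Hom (tid a) (u \o1 f)) (n : Hom (f \o1 u) (tid b)).
Local Notation I := idcell.
Let eta := Cell e.
Let eps := Cell n.

Definition zigzag_l := (eps ∗ I f) • (I f ∗ eta).
Definition zigzag_r := (I u ∗ eps) • (eta ∗ I u).

Lemma zigzag_l_comp : ccod (I f ∗ eta) = cdom (eps ∗ I f).
Proof. exact: tcompA1. Qed.

Lemma zigzag_r_comp : ccod (eta ∗ I u) = cdom (I u ∗ eps).
Proof. exact/esym/tcompA1. Qed.

Lemma zigzag_l_dom : cdom zigzag_l = f.
Proof. rewrite vcmp_dom; [exact: tcompf11|exact: zigzag_l_comp]. Qed.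

Lemma zigzag_l_cod : ccod zigzag_l = f.
Proof. rewrite vcmp_cod; [exact: tcomp1f1|exact: zigzag_l_comp]. Qed.

Lemma zigzag_r_dom : cdom zigzag_r = u.
Proof. rewrite vcmp_dom; [exact: tcomp1f1|exact: zigzag_r_comp]. Qed.

Lemma zigzag_r_cod : ccod zigzag_r = u.
Proof. rewrite vcmp_cod; [exact: tcompf11|exact: zigzag_r_comp]. Qed.

Lemma zigzag_lE : hom_eq
    ((n \o2 idc f) \oc eq_arr (tcompA1 f u f) \oc (idc f \o2 e)) (idc f) <->
  zigzag_l = idcell f.
Proof. by rewrite -cellP vcmp_eq_arr. Qed.

Lemma zigzag_rE : hom_eq
    ((idc u \o2 n) \oc eq_arr (esym (tcompA1 u f u)) \oc (e \o2 idc u)) (idc u) <->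
  zigzag_r = idcell u.
Proof. by rewrite -cellP vcmp_eq_arr. Qed.

(** Write [zigzag_r] as [P • N]. In [P • N • P • N], interchange first exchanges the middle [N] and
    [P], then replaces the two inner factors by [P2] and [N2], whose composite is [zigzag_l]
    whiskered by [u] on both sides. *)
Lemma zigzag_r_idem : zigzag_l = idcell f -> zigzag_r • zigzag_r = zigzag_r.
Proof.
move=> zl.
have cu : ccod (I u ∗ eps) = u := tcompf11 u.
have A : (eta ∗ I u) • (I u ∗ eps) =
    (I (u \o1 f) ∗ (I u ∗ eps)) • (eta ∗ I (u \o1 (f \o1 u))).
  by rewrite -(hcmp_rl eta (I u ∗ eps)) (hcmp_lr eta (I u ∗ eps)) hcmp1f cu.
have B : (I u ∗ eps) • (I (u \o1 f) ∗ (I u ∗ eps)) =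
    (I u ∗ eps) • (I u ∗ (eps ∗ I (f \o1 u))).
  have c1 : ccod (I (f \o1 u) ∗ eps) = cdom eps := tcompf11 _.
  have c2 : ccod (eps ∗ I (f \o1 u)) = cdom eps := tcomp1f1 _.
  rewrite -(hcmp_id u f) -hcmpA (hcmpA (I f)) hcmp_id.
  rewrite -(whisker_l u c1) -(whisker_l u c2); congr (_ ∗ _).
  have -> : eps • (I (f \o1 u) ∗ eps) = eps ∗ eps.
    by rewrite (hcmp_lr eps eps) hcmpf1.
  by rewrite (hcmp_rl eps eps) hcmp1f.
have D : (eta ∗ I (u \o1 (f \o1 u))) • (eta ∗ I u) =
    ((I (u \o1 f) ∗ eta) ∗ I u) • (eta ∗ I u).
  have c1 : ccod eta = cdom (eta ∗ I (u \o1 f)) := esym (tcomp1f1 _).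
  have c2 : ccod eta = cdom (I (u \o1 f) ∗ eta) := esym (tcompf11 _).
  rewrite [_ \o1 (_ \o1 _)]tcompA1 -(hcmp_id (u \o1 f) u) hcmpA.
  rewrite -(whisker_r u c1) -(whisker_r u c2); congr (_ ∗ _).
  have -> : (I (u \o1 f) ∗ eta) • eta = eta ∗ eta.
    by rewrite (hcmp_rl eta eta) hcmpf1.
  by rewrite (hcmp_lr eta eta) hcmp1f.
(* This is where the first triangle identity enters. *)
have M : (I u ∗ (eps ∗ I (f \o1 u))) • ((I (u \o1 f) ∗ eta) ∗ I u) =
    I (u \o1 f \o1 u).
  have c1 : ccod (I f ∗ eta ∗ I u) = cdom (eps ∗ I f ∗ I u).
    by rewrite /= -/(I f) ; exact: (congr1 (fun x => x \o1 u) zigzag_l_comp).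
  have -> : I u ∗ (eps ∗ I (f \o1 u)) = I u ∗ (eps ∗ I f ∗ I u).
    by rewrite -(hcmp_id f u) !hcmpA.
  have -> : (I (u \o1 f) ∗ eta) ∗ I u = I u ∗ (I f ∗ eta ∗ I u).
    by rewrite -(hcmp_id u f) -!hcmpA.
  rewrite -(whisker_l u c1) -(whisker_r u zigzag_l_comp).
  by rewrite -/zigzag_l zl !hcmp_id; congr idcell; exact: tcompA1.
(* The equations below match the endpoints, as [vcmpA] requires; they come from the strict laws for
   1-cells. *)
have uu := tcompA1 u f u.
have e1 : ccod (eta ∗ I u) = cdom (I u ∗ eps) := zigzag_r_comp.
have e2 : ccod (I u ∗ eps) = cdom (eta ∗ I u).
  exact: etrans (tcompf11 u) (esym (tcomp1f1 u)).
move: A B D M e1 e2.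
set P := I u ∗ eps; set N := eta ∗ I u; set P1 := I (u \o1 f) ∗ P.
set N1 := eta ∗ I (u \o1 (f \o1 u)); set P2 := I u ∗ (eps ∗ I (f \o1 u)).
set N2 := _ ∗ I u => A B D M e1 e2.
have e3 : ccod N1 = cdom P1 by [].
have e4 : ccod P1 = cdom P.
  exact: etrans (congr1 (comp1 (u \o1 f)) (tcompf11 u)) (esym uu).
have e5 : ccod N = cdom N1 by exact: etrans e1 (esym (tcomp1f1 _)).
have e6 : ccod P2 = cdom P by exact: (congr1 (comp1 u) (tcomp1f1 _)).
have e7 : ccod N = cdom N2.
  exact: (congr1 (fun x => x \o1 u) (esym (tcompf11 (u \o1 f)))).
have e8 : ccod N2 = cdom P2.
  rewrite -[RHS]/(u \o1 (f \o1 u \o1 (f \o1 u))).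
  rewrite -[LHS]/(u \o1 f \o1 (u \o1 f) \o1 u).
  apply: etrans (esym (tcompA1 _ _ _)) _; apply: etrans (congr1 _ (esym uu)) _.
  apply: etrans (esym (tcompA1 _ _ _)) _; congr (_ \o1 _); exact: tcompA1.
have e9 : ccod (N2 • N) = cdom P1 by rewrite -D vcmp_cod.
have e10 : ccod (P • N) = cdom N by rewrite vcmp_cod.
have e11 : ccod (N2 • N) = cdom P2 by rewrite vcmp_cod.
rewrite /zigzag_r -/P -/N -(vcmpA e10 e1) (vcmpA e1 e2) A.
rewrite -(vcmpA e5 e3) D (vcmpA e9 e4) B -(vcmpA e11 e6).
by rewrite (vcmpA e7 e8) M vcmp1f.
Qed.
End Triangles.

Lemma cell_idem (C : category) (t t' : cell C) x : cdom t = x -> ccod t = x ->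
  cdom t' = x -> ccod t' = x -> t' • t = idcell x -> t • t = t -> t = idcell x.
Proof.
move=> dt ct dt' ct' inv idem; rewrite -(vcmp1f ct) -inv -vcmpA ?idem //; congruence.
Qed.

Definition cell_map (C D : category) (F : functor C D) (f : cell C) : cell D :=
  Cell (farr F (carr f)).

Lemma cell_map_vcmp (C D : category) (F : functor C D) (g f : cell C) :
  ccod f = cdom g -> cell_map F (g • f) = cell_map F g • cell_map F f.
Proof.
case: g f => [y z g] [x y' f] /= e; case: y / e g => g.
by rewrite /cell_map !vcmpE /= farrM.
Qed.

Lemma cell_map_id (C D : category) (F : functor C D) (x : C) :
  cell_map F (idcell x) = idcell (F x).
Proof. by rewrite /cell_map /= farr1. Qed.

Section Lifting.
Context (K L : two_cat) (P : two_functor K L).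
Hypothesis lift1 : forall (a b : K) (g : thom (P a) (P b)),
  exists f : thom a b, tfhom P f = g.
Hypothesis lift2 : forall (a b : K) (f g : thom a b)
  (v : Hom (tfhom P f) (tfhom P g)), exists w : Hom f g, farr (tfhom P) w = v.
Hypothesis lift_inv : forall (a b : K) (f : thom a b) (w : Hom f f),
  farr (tfhom P) w = idc _ ->
  exists2 w' : Hom f f, w' \oc w = idc f & w \oc w' = idc f.

Local Notation "P @ x" := (cell_map (tfhom P) x) (at level 30).

Lemma cell_map_hcmp (a b c : K) (G : cell (thom b c)) (F : cell (thom a b)) :
  P @ (G ∗ F) = (P @ G) ∗ (P @ F).
Proof. by apply/cellP; exact: tf_comp2. Qed.

Lemma cell_lift (a b : K) (f g : thom a b) (V : cell (thom (P a) (P b))) :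
  cdom V = tfhom P f -> ccod V = tfhom P g ->
  exists w : Hom f g, P @ (Cell w) = V.
Proof.
move=> dV cV; have [v <-] := cell_hom dV cV; have [w <-] := lift2 v.
by exists w.
Qed.

Lemma cell_inv (a b : K) (f : thom a b) (t : cell (thom a b)) :
  cdom t = f -> ccod t = f -> P @ t = idcell (tfhom P f) ->
  exists w : Hom f f, [/\ Cell w • t = idcell f, t • Cell w = idcell f &
    P @ (Cell w) = idcell (tfhom P f)].
Proof.
move=> dt ct; have [v <-] := cell_hom dt ct => /cellP /hom_eq_eq Pv.
have [w wv vw] := lift_inv Pv; exists w; rewrite !vcmpE wv vw; split=> //.
by congr Cell; rewrite /= -[LHS]cmpf1 -Pv -farrM wv farr1.
Qed.

(** A counit is corrected by the inverse of one triangle composite; the other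
    triangle composite is then both idempotent and, being over an identity,
    invertible. *)
Lemma adjunction_lift (a b : K) (j' : adjunction (P a) (P b)) :
  exists j : adjunction a b, @adjunction_over K L P a b j j'.
Proof.
case: j' => l r e' n' tl0 tr0.
have [f Pf] := lift1 l; have [u Pu] := lift1 r.
case: l / Pf e' n' tl0 tr0; case: r / Pu => e' n' tl0 tr0.
have tl := (zigzag_lE e' n').1 tl0; have tr := (zigzag_rE e' n').1 tr0.
have [||e Pe] := @cell_lift _ _ (tid a) (u \o1 f) (Cell e').
- by rewrite tf_id.
- by rewrite tf_comp1.
have [||n0 Pn0] := @cell_lift _ _ (f \o1 u) (tid b) (Cell n').
- by rewrite tf_comp1.
- by rewrite tf_id.
pose t := zigzag_l e n0.
have Pt : P @ t = idcell (tfhom P f).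
  rewrite /t /zigzag_l (cell_map_vcmp _ (zigzag_l_comp e n0)) !cell_map_hcmp.
  rewrite Pe Pn0 cell_map_id.
  exact: tl.
have [s [st ts Ps]] := cell_inv (zigzag_l_dom e n0) (zigzag_l_cod e n0) Pt.
pose n := n0 \oc (s \o2 idc u).
have nE : Cell n = Cell n0 • (Cell s ∗ idcell u) by rewrite vcmpE.
have Pn : P @ (Cell n) = Cell n'.
  rewrite nE cell_map_vcmp // cell_map_hcmp Pn0 Ps cell_map_id hcmp_id.
  by rewrite vcmpf1 //.
have zl : zigzag_l e n = idcell f.
  rewrite /zigzag_l nE whisker_r // -hcmpA hcmp_id.
  have c1 : ccod (idcell f ∗ Cell e) = cdom (Cell s ∗ idcell (u \o1 f)) by [].
  have c2 : ccod (Cell s ∗ idcell (u \o1 f)) = cdom (Cell n0 ∗ idcell f).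
    exact: tcompA1.
  have c3 : ccod (Cell s) = cdom (idcell f ∗ Cell e) by exact/esym/tcompf11.
  rewrite -(vcmpA c1 c2).
  (* Interchange slides [s] past the unit, so the new triangle composite is [t • Cell s]. *)
  have -> : (Cell s ∗ idcell (u \o1 f)) • (idcell f ∗ Cell e) =
      (idcell f ∗ Cell e) • Cell s.
    rewrite -(hcmp_lr (Cell s) (Cell e)) (hcmp_rl (Cell s) (Cell e)).
    by rewrite hcmpf1.
  by rewrite (vcmpA c3 (zigzag_l_comp e n0)).
have zr : zigzag_r e n = idcell u.
  have Pz : P @ (zigzag_r e n) = idcell (tfhom P u).
    rewrite /zigzag_r (cell_map_vcmp _ (zigzag_r_comp e n)) !cell_map_hcmp.
    rewrite Pe Pn cell_map_id.
    exact: tr.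
  have [s' [h _ _]] := cell_inv (zigzag_r_dom e n) (zigzag_r_cod e n) Pz.
  apply: cell_idem (zigzag_r_dom e n) (zigzag_r_cod e n) _ _ h (zigzag_r_idem zl) => //.
exists (Adjunction ((zigzag_lE e n).2 zl) ((zigzag_rE e n).2 zr)).
by split=> //=; apply/cellP.
Qed.
End Lifting.

(** * The canonical 2-functor on hom-categories *)

Section Canonical.
Context (S : scat) (z : S) (I : Type) (dom : I -> S)
  (proj : forall i, shom (dom i) z 0) (i j : I).
Hypotheses (domq : is_qcat (shom (dom i) (dom j)))
  (zq : is_qcat (shom (dom i) z))
  (projI : inner_fib (spostcomp (dom i) (proj j))).
Local Notation F := (canonical_hom proj i j).

(** Whiskering with [proj j] acts on 2-cells as [ho] of postcomposition in [S], so a 2-cell of the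
    slice is an arrow to which [ho_fibre_full] applies. *)
Lemma canonical_full (f g : ho (sslice_hom proj i j)) (v : Hom (F f) (F g)) :
  exists w : Hom f g, farr F w = v.
Proof.
case: v => v vP.
have [|w wv] := ho_fibre_full domq zq projI (x := f) (y := g) (a := v).
  apply: hom_eq_trans vP; exact/hom_eq_of_eq/esym/postcomp_hstar.
by exists w; apply: sval_eq.
Qed.

Lemma canonical_inv (f : ho (sslice_hom proj i j)) (w : Hom f f) :
  farr F w = idc _ ->
  exists2 w' : Hom f f, w' \oc w = idc f & w \oc w' = idc f.
Proof. by move=> /(congr1 sval); exact: (ho_fibre_inv domq zq projI). Qed.
End Canonical.

Lemma qCat_inf_postcomp (E : qcat) (A : qcat) (q : isofib A) :
  inner_fib (spostcomp (S := qCat_inf) E (b := idom q) (c := A) (map_vertex q)).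
Proof.
apply: (@map_space_inner_fib _ _ _ q); first exact: spostcomp_map.
by case: (isofibP q).
Qed.

Lemma qCat_inf_hom (A B : qcat) : is_qcat (@shom qCat_inf A B).
Proof. exact/map_space_qcat/qcatP. Qed.

Theorem corollary4p5p3 (A : qcat) (p q : isofib A)
    (j : @adjunction (qCat_2_over A) p q) :
  exists j' : @adjunction (hstar (qCat_inf_over A)) p q,
    @adjunction_over (hstar (qCat_inf_over A)) (qCat_2_over A)
      (canonical_over A) p q j' j.
Proof.
apply: adjunction_lift => a b.
(* On 1-cells only the packaging of the commutation proof differs. *)
- by move=> g; exists (exist _ (sval g) (svalP g)); exact: sval_eq.
- exact: (@canonical_full qCat_inf A (isofib A) (@idom A) (fun r => map_vertex r)
    a b (@qCat_inf_hom _ _) (@qCat_inf_hom _ _) (@qCat_inf_postcomp _ _ b)).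
- exact: (@canonical_inv qCat_inf A (isofib A) (@idom A) (fun r => map_vertex r)
    a b (@qCat_inf_hom _ _) (@qCat_inf_hom _ _) (@qCat_inf_postcomp _ _ b)).
Qed.
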